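(* Let $T_0>0$ and let $(F,\Psi,\mathfrak{P})$ be a Wu solution on $[0,T_0]$ (as defined in the context), with associated homeomorphisms $h(\cdot,t):\mathbb{R}\to\mathbb{R}$, singular sets $S(t)$ and non-singular sets $NS(t)$. Assume that there exist $N\ge1$ isolated singularities of the initial interface at (distinct) locations $\alpha_n\in S(0)$, $1\le n\le N$, in conformal coordinates (i.e. each $\alpha_n$ is an isolated point of $S(0)$). Also assume that there exist unit vectors $\beta_n,\gamma_n\in\mathbb{C}$ for $1\le n\le N$ such that $$\lim_{\alpha\to\alpha_n^-}\frac{Z_{,\alpha'}}{|Z_{,\alpha'}|}(\alpha,0)=\beta_n\quad\text{and}\quad\lim_{\alpha\to\alpha_n^+}\frac{Z_{,\alpha'}}{|Z_{,\alpha'}|}(\alpha,0)=\gamma_n\quad\text{for }1\le n\le N.$$ Then for all $t\in[0,T_0]$ there are $N$ isolated singularities of the interface at the locations $h(\alpha_n,t)\in S(t)$, $1\le n\le N$, in conformal coordinates (i.e. each $h(\alpha_n,t)$ is an isolated point of $S(t)$), and $$\lim_{\alpha\to\alpha_n^-}\frac{Z_{,\alpha'}}{|Z_{,\alpha'}|}(h(\alpha,t),t)=\beta_n\quad\text{and}\quad\lim_{\alpha\to\alpha_n^+}\frac{Z_{,\alpha'}}{|Z_{,\alpha'}|}(h(\alpha,t),t)=\gamma_n\quad\text{for }1\le n\le N.$$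
   Context: **Notation.** Identify $\mathbb{R}^2$ with $\mathbb{C}$. $P_-=\{z'=x'+iy' : y'<0\}$ is the lower half plane, $\overline{P}_-$ its closure, with boundary $\mathbb{R}$. $\partial_{z'}=\frac12(\partial_{x'}-i\partial_{y'})$; subscripts $t,z',\alpha,\alpha'$ denote partial derivatives (except in the symbols $Z_t,Z_{tt}$, defined below). $\|\cdot\|_p$ is the $L^p(\mathbb{R})$ norm; $\|f\|_{\dot H^{1/2}}=\||\xi|^{1/2}\hat f\|_2$. $K_y(x)=\frac{-y}{\pi(x^2+y^2)}$ for $y<0$ is the Poisson kernel; $*$ is convolution in the real variable. Compositions and inverses are in the spatial variable. $f_\epsilon\Rightarrow f$ on $U$ means uniform convergence on compact subsets of $U$. $C(\cdot)$ denotes finite quantities depending only on the indicated arguments. Convention: if a function (or a product such as $\frac{1}{\Psi_{z'}}F_{z'}$) defined on $P_-$ extends continuously to $\overline{P}_-$, its value at a boundary point is that of the continuous extension. **Water wave system in $P_-$.** For $F,\Psi$ complex valued and $\mathfrak P$ real valued: (i) $F_t-\Psi_t\frac{F_{z'}}{\Psi_{z'}}+\overline F\frac{F_{z'}}{\Psi_{z'}}=-\frac{1}{\Psi_{z'}}(\partial_{x'}-i\partial_{y'})\mathfrak P+i$ on $P_-$; (ii) $F(\cdot,t)$ holomorphic and $\Psi(\cdot,t)$ conformal on $P_-$; (iii) $\mathfrak P=0$ on $\partial P_-$; (iv) the trace of $\frac{1}{\Psi_{z'}}(\overline F-\Psi_t)$ on $\partial P_-$ is real valued; with $F\to0$, $(\partial_{x'}-i\partial_{y'})\mathfrak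 P\to i$, $\Psi_{z'}\to1$, $\Psi_t\to0$ as $z'\to\infty$. **Energy.** All norms are in $x'$ at height $y'$: $\mathcal E_1(t)=\sup_{y'<0}\|F_{z'}\|_{L^2}^2+\sup_{y'<0}\|\frac{1}{\Psi_{z'}}F_{z'}\|_{\dot H^{1/2}}^2+\sup_{y'<0}\|\frac{1}{\Psi_{z'}}\partial_{z'}(\frac{1}{\Psi_{z'}}F_{z'})\|_{L^2}^2+\sup_{y'<0}\|\frac{1}{\Psi_{z'}^2}\partial_{z'}(\frac{1}{\Psi_{z'}}F_{z'})\|_{\dot H^{1/2}}^2+\sup_{y'<0}\|\frac{1}{\Psi_{z'}}\|_{L^\infty}^2+\sup_{y'<0}\|\partial_{z'}(\frac{1}{\Psi_{z'}})\|_{L^2}^2+\sup_{y'<0}\|\frac{1}{\Psi_{z'}}\partial_{z'}(\frac{1}{\Psi_{z'}}\partial_{z'}(\frac{1}{\Psi_{z'}}))\|_{L^2}^2$. **Initial data.** $F(\cdot,0),\Psi(\cdot,0)$ are holomorphic on $P_-$, $\Psi(\cdot,0)$ is conformal onto a domain whose boundary is a Jordan curve, $\Psi_{z'}(z',0)\to1$ as $z'\to\infty$; $\mathfrak P(\cdot,0)$ is the unique solution of $\Delta\mathfrak P=-2|F_{z'}|^2$ on $P_-$, $\mathfrak P=0$ on $\partial P_-$, $(\partial_{x'}+i\partial_{y'})\mathfrak P\to-i$ at infinity; and $\mathcal E_1(0)<\infty$, $c_0:=\sup_{y'<0}\|F(\cdot+iy',0)\|_{L^2}+\sup_{y'<0}\|\frac{1}{\Psi_{z'}(\cdot+iy',0)}-1\|_{L^2}<\infty$.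 **Wu solution on $[0,T_0]$.** This is a solution produced by Wu's existence theorem from such data. Concretely it is a solution $(F,\Psi,\mathfrak P)$ of the system on $[0,T_0]$ with the following properties. (1) $\Psi$ is $C^1$ on $P_-\times[0,T_0]$, each $\Psi(\cdot,t)$ is conformal, and $\Psi,\frac1{\Psi_{z'}},\frac{\Psi_t}{\Psi_{z'}}$ are continuous on $\overline P_-\times[0,T_0]$; $F$ is bounded and continuous on $\overline P_-\times[0,T_0]$, $C^1$ on $P_-\times[0,T_0]$, each $F(\cdot,t)$ holomorphic; $\mathfrak P$ is continuous on $\overline P_-\times[0,T_0]$ and $C^1$ on $P_-\times[0,T_0]$; for all $t$, $\mathcal E_1(t)<\infty$ and $\sup_{y'<0}\|F(\cdot+iy',t)\|_{L^2}+\sup_{y'<0}\|\frac1{\Psi_{z'}(\cdot+iy',t)}-1\|_{L^2}<\infty$. (2) Smooth approximations. For each $0<\epsilon\le1$ there is a solution $(F^\epsilon,\Psi^\epsilon,\mathfrak P^\epsilon)$ of the system on $[0,T_0]$, smooth up to the boundary, with $F^\epsilon(z',0)=F(z'-\epsilon i,0)$, $\Psi^\epsilon(z',0)=\Psi(z'-\epsilon i,0)$. Write $Z^\epsilon(\alpha',t)=\Psi^\epsilon(\alpha',t)$, $Z^\epsilon_{,\alpha'}=\partial_{\alpha'}Z^\epsilon$, $Z_t^\epsilon=\overline{F^\epsilon}|_{\mathbb R}$, $Z^\epsilon_{t,\alpha'}=\partial_{\alpha'}Z^\epsilon_t$, $b^\epsilon=\frac{1}{\Psi^\epsilon_{z'}}(\overline{F^\epsilon}-\Psi^\epsilon_t)|_{\mathbb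 R}$; $h^\epsilon$ is the flow $h^\epsilon_t=b^\epsilon\circ h^\epsilon$, $h^\epsilon(\alpha,0)=\alpha$; $z^\epsilon=Z^\epsilon\circ h^\epsilon$ (so $z^\epsilon_t=Z_t^\epsilon\circ h^\epsilon$), $Z^\epsilon_{tt}=z^\epsilon_{tt}\circ(h^\epsilon)^{-1}$; $A_1^\epsilon(\alpha',t)=1+\frac1{2\pi}\int\frac{|Z_t^\epsilon(\alpha',t)-Z_t^\epsilon(\beta',t)|^2}{(\alpha'-\beta')^2}d\beta'$. On $\mathbb R$: $\frac{1}{\Psi^\epsilon_{z'}}(\partial_{x'}-i\partial_{y'})\mathfrak P^\epsilon=i\frac{A_1^\epsilon}{Z^\epsilon_{,\alpha'}}$ and $\overline{Z^\epsilon_{tt}}-i=-i\frac{A_1^\epsilon}{Z^\epsilon_{,\alpha'}}$. Moreover $\mathfrak P^\epsilon=-\frac12|F^\epsilon|^2-y'+\frac12K_{y'}*(|Z_t^\epsilon|^2)$. (3) Uniform bounds for all $0<\epsilon\le1$, $t\in[0,T_0]$: the quantities $\|Z^\epsilon_{t,\alpha'}\|_2$, $\|\partial_{\alpha'}\frac1{Z^\epsilon_{,\alpha'}}\|_2$, $\|A_1^\epsilon\|_\infty$, $\|\frac1{Z^\epsilon_{,\alpha'}}\partial_{\alpha'}A_1^\epsilon\|_2$, $\|b^\epsilon_{\alpha'}\|_\infty$, $\|\frac{h^\epsilon_{t\alpha}}{h^\epsilon_\alpha}\|_\infty$, $\|\frac{z^\epsilon_{t\alpha}}{z^\epsilon_\alpha}\|_\infty$,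 $\|\partial_{\alpha'}(\frac{1}{(Z^\epsilon_{,\alpha'})^2}Z^\epsilon_{t,\alpha'})\|_2$ (and the same with $\overline{Z^\epsilon_{t,\alpha'}}$ in place of $Z^\epsilon_{t,\alpha'}$) are at most $C(\mathcal E_1(0))$; $\|Z_t^\epsilon\|_\infty+\|\frac1{Z^\epsilon_{,\alpha'}}\|_\infty\le C(c_0,\mathcal E_1(0))$; and there are $0<c_1,c_2<\infty$ depending only on $\mathcal E_1(0)$ with $c_1\le|h^\epsilon_\alpha(\alpha,t)|\le c_2$, $c_1|z^\epsilon_\alpha(\alpha,0)|\le|z^\epsilon_\alpha(\alpha,t)|\le c_2|z^\epsilon_\alpha(\alpha,0)|$, $|z^\epsilon_{t\alpha}(\alpha,t)|\le c_2|z^\epsilon_\alpha(\alpha,0)|$. (4) Convergence along a sequence $\epsilon=\epsilon_j\to0$. There is a continuous $h:\mathbb R\times[0,T_0]\to\mathbb R$, each $h(\cdot,t)$ a homeomorphism, $h(\alpha,0)=\alpha$, with $h^\epsilon\Rightarrow h$, $(h^\epsilon)^{-1}\Rightarrow h^{-1}$ on $\mathbb R\times[0,T_0]$, and $0<c_1\le\frac{h(\alpha,t)-h(\beta,t)}{\alpha-\beta}\le c_2<\infty$ for $\alpha\ne\beta$. There is a continuous $z:\mathbb R\times[0,T_0]\to\mathbb C$, twice continuously differentiable in $t$ with $z_t,z_{tt}$ bounded and continuous, and $z^\epsilon\Rightarrow z$, $z^\epsilon_t\Rightarrow z_t$, $z^\epsilon_{tt}\Rightarrow z_{tt}$. Put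 $Z=z\circ h^{-1}$, $Z_t=z_t\circ h^{-1}$, $Z_{tt}=z_{tt}\circ h^{-1}$; then $Z^\epsilon\Rightarrow Z$, $Z_t^\epsilon\Rightarrow Z_t$, $Z_{tt}^\epsilon\Rightarrow Z_{tt}$ on $\mathbb R\times[0,T_0]$, $Z(\alpha',t)=\Psi(\alpha',t)$ and $\overline{Z_t}(\alpha',t)=F(\alpha',t)$. On $\overline P_-\times[0,T_0]$: $\Psi^\epsilon\Rightarrow\Psi$, $\frac1{\Psi^\epsilon_{z'}}\Rightarrow\frac1{\Psi_{z'}}$, $\frac{\Psi^\epsilon_t}{\Psi^\epsilon_{z'}}\Rightarrow\frac{\Psi_t}{\Psi_{z'}}$, $F^\epsilon\Rightarrow F$, $\mathfrak P^\epsilon\Rightarrow\mathfrak P$. On $P_-\times[0,T_0]$: $\Psi^\epsilon_t\Rightarrow\Psi_t$, $\Psi^\epsilon_{z'}\Rightarrow\Psi_{z'}$, $F^\epsilon_{z'}\Rightarrow F_{z'}$, $F^\epsilon_t\Rightarrow F_t$, $(\partial_{x'}-i\partial_{y'})\mathfrak P^\epsilon\Rightarrow(\partial_{x'}-i\partial_{y'})\mathfrak P$. Finally $\mathfrak P=-\frac12|F|^2-y'+\frac12K_{y'}*(|Z_t|^2)$ on $P_-\times[0,T_0]$. **Singular set.** $S(t)=\{\alpha'\in\mathbb{R} : \frac{1}{\Psi_{z'}}(\alpha',t)=0\}$ and $NS(t)=\mathbb{R}\setminus S(t)$. For $\alpha'\in NS(t)$, $Z_{,\alpha'}(\alpha',t)\neq0$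 denotes $\partial_{\alpha'}Z(\alpha',t)$, i.e. the boundary value of $\Psi_{z'}(\cdot,t)$ at $\alpha'$ (the reciprocal of the boundary value of $\frac1{\Psi_{z'}}$). One-sided limits of $\frac{Z_{,\alpha'}}{|Z_{,\alpha'}|}$ at an isolated point of the singular set are taken through nearby non-singular points. *)

(* Defs.v *)
From HB Require Import structures.
From mathcomp Require Import all_boot all_order all_algebra.
From mathcomp Require Import complex.
From mathcomp Require Import all_classical all_reals all_analysis.

Set Implicit Arguments.
Unset Strict Implicit.
Unset Printing Implicit Defensive.

Import Order.TTheory GRing.Theory Num.Theory.
Import numFieldNormedType.Exports.

Local Open Scope classical_set_scope.
Local Open Scope ring_scope.
Local Open Scope complex_scope.

(* [R[i]] with the topology of its modulus, as a normed space over itself. *)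
HB.instance Definition _ (R : realType) := NormedModule.copy R[i] R[i]^o.

Section HalfPlane.
Variable R : realType.
Local Notation C := R[i].
Local Notation mu := (@lebesgue_measure R).

Definition modulus (w : C) : R := Normc.normc w.

Definition lhp : set C := [set z | complex.Im z < 0].
Definition clhp : set C := [set z | complex.Im z <= 0].

(* The filter "z' -> oo, z' in P_-". *)
Definition lhp_infty : set_system C :=
  filter_from setT (fun M : R => [set z | lhp z /\ M < modulus z]).

(* Derivative of a complex-valued function of a real variable, relative to a
   set A; it is one-sided at the end points of an interval A. *)
Definition diff_quot (f : R -> C) (x y : R) : C := (f y - f x) / (y - x)%:C.

Definition has_deriv (A : set R) (f : R -> C) (x : R) (l : C) : Prop :=
  diff_quot f x y @[y --> within A x^'] --> l.

Definition ex_deriv (A : set R) (f : R -> C) (x : R) : Prop :=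
  cvg (diff_quot f x y @[y --> within A x^']).

Definition deriv (A : set R) (f : R -> C) (x : R) : C :=
  lim (diff_quot f x y @[y --> within A x^']).

Definition hline (g : C -> C) (y : R) : R -> C := fun x => g (x +i* y).
Definition vline (g : C -> C) (x : R) : R -> C := fun y => g (x +i* y).

Definition dx (g : C -> C) (z : C) : C :=
  deriv setT (hline g (complex.Im z)) (complex.Re z).
Definition dy (g : C -> C) (z : C) : C :=
  deriv setT (vline g (complex.Re z)) (complex.Im z).
Definition dz (g : C -> C) (z : C) : C := (dx g z - 'i * dy g z) / 2%:R.

(* Time derivative on [0, T0] and derivative along the real line, for
   functions of a spatial variable and of time. *)
Definition dt (T0 : R) (X : Type) (G : X -> R -> C) (x : X) (t : R) : C :=
  deriv `[0, T0] (G x) t.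
Definition da (g : R -> R -> C) (a t : R) : C := deriv setT (g ^~ t) a.

Definition cplx (X : Type) (p : X -> R -> R) : X -> R -> C :=
  fun x t => (p x t)%:C.

Definition grad_conj (p : C -> R) (z : C) : C :=
  dx (fun w => (p w)%:C) z - 'i * dy (fun w => (p w)%:C) z.
Definition grad (p : C -> R) (z : C) : C :=
  dx (fun w => (p w)%:C) z + 'i * dy (fun w => (p w)%:C) z.

Definition laplacian (p : C -> R) (z : C) : C :=
  dx (dx (fun w => (p w)%:C)) z + dy (dy (fun w => (p w)%:C)) z.

(* A function defined on P_-, extended to the boundary by its limits from
   inside.  It extends continuously to the closed half plane if and only if
   [bext g] is continuous there. *)
Definition bext (g : C -> C) (z : C) : C :=
  if complex.Im z < 0 then g z else lim (g w @[w --> within lhp (nbhs z)]).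

Definition cont_on (X : topologicalType) (D : set X) (T0 : R)
    (V : topologicalType) (G : X -> R -> V) : Prop :=
  {within D `*` `[0, T0], continuous (fun p : X * R => G p.1 p.2)}.

Definition ex_dx (g : C -> C) (z : C) : Prop :=
  ex_deriv setT (hline g (complex.Im z)) (complex.Re z).
Definition ex_dy (g : C -> C) (z : C) : Prop :=
  ex_deriv setT (vline g (complex.Re z)) (complex.Im z).

Definition C1_lhp (g : C -> C) : Prop :=
  [/\ forall z, lhp z -> ex_dx g z /\ ex_dy g z,
      {within lhp, continuous g},
      {within lhp, continuous (dx g)} &
      {within lhp, continuous (dy g)}].

Definition C2_lhp (g : C -> C) : Prop :=
  [/\ C1_lhp g, C1_lhp (dx g) & C1_lhp (dy g)].

Definition C1_lhp_time (T0 : R) (G : C -> R -> C) : Prop :=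
  [/\ forall z t, lhp z -> 0 <= t <= T0 ->
        [/\ ex_dx (G ^~ t) z, ex_dy (G ^~ t) z & ex_deriv `[0, T0] (G z) t],
      cont_on lhp T0 G,
      cont_on lhp T0 (fun z t => dx (G ^~ t) z),
      cont_on lhp T0 (fun z t => dy (G ^~ t) z) &
      cont_on lhp T0 (dt T0 G)].

(* C^infty in (x', y', t) up to the boundary: D i j k is the partial derivative
   of order (i, j, k), one-sided where (z, t) is a boundary point. *)
Definition smooth_clhp (T0 : R) (G : C -> R -> C) : Prop :=
  exists D : nat -> nat -> nat -> C -> R -> C,
    (forall z t, clhp z -> 0 <= t <= T0 -> D 0%N 0%N 0%N z t = G z t) /\
    forall i j k : nat, cont_on clhp T0 (D i j k) /\
      forall z t, clhp z -> 0 <= t <= T0 ->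
        [/\ has_deriv setT (hline (D i j k ^~ t) (complex.Im z)) (complex.Re z)
              (D i.+1 j k z t),
            has_deriv `]-oo, 0] (vline (D i j k ^~ t) (complex.Re z))
              (complex.Im z) (D i j.+1 k z t) &
            has_deriv `[0, T0] (D i j k z) t (D i j k.+1 z t)].

Definition smooth_line (T0 : R) (g : R -> R -> C) : Prop :=
  exists D : nat -> nat -> R -> R -> C,
    (forall a t, 0 <= t <= T0 -> D 0%N 0%N a t = g a t) /\
    forall i k : nat, cont_on setT T0 (D i k) /\
      forall a t, 0 <= t <= T0 ->
        has_deriv setT (D i k ^~ t) a (D i.+1 k a t) /\
        has_deriv `[0, T0] (D i k a) t (D i k.+1 a t).

Definition holomorphic_on (D : set C) (f : C -> C) : Prop :=
  forall z, D z -> derivable f z 1.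

(* Conformal in the sense of a nonvanishing complex derivative; injectivity is
   only required of the initial Riemann map, see [water_data]. *)
Definition conformal_on (D : set C) (f : C -> C) : Prop :=
  holomorphic_on D f /\ forall z, D z -> dz f z != 0.

Definition norm2 (g : R -> C) : \bar R :=
  Lnorm mu 2%:E (fun x : R => (modulus (g x))%:E).
Definition norm_oo (g : R -> C) : \bar R :=
  Lnorm mu +oo%E (fun x : R => (modulus (g x))%:E).

Definition cmeasurable (g : R -> C) : Prop :=
  measurable_fun setT (fun x : R => complex.Re (g x)) /\
  measurable_fun setT (fun x : R => complex.Im (g x)).

Definition Cintegral (D : set R) (g : R -> C) : C :=
  Rintegral mu D (fun x : R => complex.Re (g x)) +i*
  Rintegral mu D (fun x : R => complex.Im (g x)).

Definition fourier_trunc (g : R -> C) (n : nat) (xi : R) : C :=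
  (Num.sqrt (2 * pi))^-1%:C *
  Cintegral `[- n%:R, n%:R] (fun x => (cos (x * xi) -i* sin (x * xi)) * g x).

(* ghat is (a representative of) the Fourier-Plancherel transform of g in L^2 *)
Definition is_fourier (g ghat : R -> C) : Prop :=
  [/\ cmeasurable g, (norm2 g < +oo)%E, cmeasurable ghat &
      norm2 (fun xi => ghat xi - fourier_trunc g n xi) @[n --> \oo] --> 0%E].

(* For g in L^2 the infimum is over the representatives of one class, all with
   the same value; for g not in L^2 it is +oo.  In [energy1] the functions
   measured are products of an L^2 and an L^infty function whose norms also
   occur there, hence in L^2 as soon as the other terms are finite. *)
Definition norm_Hhalf (g : R -> C) : \bar R :=
  ereal_inf [set norm2 (fun xi => (Num.sqrt `|xi|)%:C * ghat xi)
            | ghat in is_fourier g].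

Definition sup_lhp (N : (R -> C) -> \bar R) (g : C -> C) : \bar R :=
  ereal_sup [set N (hline g y) | y in [set y : R | y < 0]].

Definition invdz (psi : C -> C) (z : C) : C := (dz psi z)^-1.
(* (1 / psi_z') d_z' g *)
Definition Dpsi (psi g : C -> C) (z : C) : C := invdz psi z * dz g z.

Definition energy1 (f psi : C -> C) : \bar R :=
  (sup_lhp norm2 (dz f) ^+ 2
   + sup_lhp norm_Hhalf (Dpsi psi f) ^+ 2
   + sup_lhp norm2 (Dpsi psi (Dpsi psi f)) ^+ 2
   + sup_lhp norm_Hhalf (fun z => invdz psi z ^+ 2 * dz (Dpsi psi f) z)%R ^+ 2
   + sup_lhp norm_oo (invdz psi) ^+ 2
   + sup_lhp norm2 (dz (invdz psi)) ^+ 2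
   + sup_lhp norm2 (Dpsi psi (Dpsi psi (invdz psi))) ^+ 2)%E.

Definition c0 (f psi : C -> C) : \bar R :=
  (sup_lhp norm2 f + sup_lhp norm2 (fun z => invdz psi z - 1)%R)%E.

(* A Jordan curve through infinity. *)
Definition jordan_curve (G : set C) : Prop :=
  exists gam : R -> C,
    [/\ continuous gam, injective gam,
        modulus (gam s) @[s --> +oo] --> +oo,
        modulus (gam s) @[s --> -oo] --> +oo & range gam = G].

Record water_data (f psi : C -> C) (p : C -> R) : Prop := {
  data_f : holomorphic_on lhp f;
  data_psi : conformal_on lhp psi;
  data_inj : forall z w, lhp z -> lhp w -> psi z = psi w -> z = w;
  data_jordan : jordan_curve (closure (psi @` lhp) `\` interior (psi @` lhp));
  data_dpsi_infty : dz psi z @[z --> lhp_infty] --> (1 : C);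
  data_p_C2 : C2_lhp (fun z => (p z)%:C);
  data_p_cont : {within clhp, continuous p};
  data_p_laplacian : forall z, lhp z ->
    laplacian p z = (- 2 * modulus (dz f z) ^+ 2)%:C;
  data_p_boundary : forall a : R, p a%:C = 0;
  data_p_infty : grad p z @[z --> lhp_infty] --> (- 'i : C);
  data_energy : (energy1 f psi < +oo)%E;
  data_c0 : (c0 f psi < +oo)%E }.

(* Its boundary trace is the velocity b of the flow h. *)
Definition transport (T0 : R) (F Psi : C -> R -> C) (t : R) (z : C) : C :=
  invdz (Psi ^~ t) z * ((F z t)^* - dt T0 Psi z t).

Record water_wave (T0 : R) (F Psi : C -> R -> C) (P : C -> R -> R) : Prop := {
  ww_euler : forall z t, lhp z -> 0 <= t <= T0 ->
    dt T0 F z t - dt T0 Psi z t * (dz (F ^~ t) z / dz (Psi ^~ t) z)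
      + (F z t)^* * (dz (F ^~ t) z / dz (Psi ^~ t) z)
    = - (dz (Psi ^~ t) z)^-1 * grad_conj (P ^~ t) z + 'i;
  ww_holo : forall t, 0 <= t <= T0 -> holomorphic_on lhp (F ^~ t);
  ww_conformal : forall t, 0 <= t <= T0 -> conformal_on lhp (Psi ^~ t);
  ww_pressure : forall (a t : R), 0 <= t <= T0 -> P a%:C t = 0;
  ww_trace : forall (a t : R), 0 <= t <= T0 -> exists b : R,
    transport T0 F Psi t z @[z --> within lhp (nbhs (a%:C : C))] --> (b%:C : C);
  ww_F_infty : forall t, 0 <= t <= T0 -> F z t @[z --> lhp_infty] --> (0 : C);
  ww_P_infty : forall t, 0 <= t <= T0 ->
    grad_conj (P ^~ t) z @[z --> lhp_infty] --> ('i : C);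
  ww_dPsi_infty : forall t, 0 <= t <= T0 ->
    dz (Psi ^~ t) z @[z --> lhp_infty] --> (1 : C);
  ww_Psit_infty : forall t, 0 <= t <= T0 ->
    dt T0 Psi z t @[z --> lhp_infty] --> (0 : C) }.

Definition Zof (Psi : C -> R -> C) (a t : R) : C := Psi a%:C t.
Definition Ztof (F : C -> R -> C) (a t : R) : C := (F a%:C t)^*.
Definition Zaof (Psi : C -> R -> C) : R -> R -> C := da (Zof Psi).
Definition Ztaof (F : C -> R -> C) : R -> R -> C := da (Ztof F).
Definition bof (T0 : R) (F Psi : C -> R -> C) (a t : R) : C :=
  bext (transport T0 F Psi t) a%:C.
Definition zof (Psi : C -> R -> C) (h : R -> R -> R) (a t : R) : C :=
  Zof Psi (h a t) t.
Definition A1of (F : C -> R -> C) (a t : R) : R :=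
  1 + (2 * pi)^-1 * Rintegral mu setT
        (fun b : R => modulus (Ztof F a t - Ztof F b t) ^+ 2 / (a - b) ^+ 2).
Definition Zttof (T0 : R) (z : R -> R -> C) (hinv : R -> R -> R) (a t : R) : C :=
  dt T0 (dt T0 z) (hinv a t) t.

Definition poisson (y x : R) : R := - y / (pi * (x ^+ 2 + y ^+ 2)).
Definition pressure_formula (T0 : R) (F : C -> R -> C) (P : C -> R -> R) : Prop :=
  forall z t, lhp z -> 0 <= t <= T0 ->
    P z t = - 2^-1 * modulus (F z t) ^+ 2 - complex.Im z
      + 2^-1 * Rintegral mu setT (fun s : R =>
          poisson (complex.Im z) (complex.Re z - s) * modulus (Ztof F s t) ^+ 2).

Definition spatial_inverse (T0 : R) (h hinv : R -> R -> R) : Prop :=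
  forall t, 0 <= t <= T0 -> cancel (h ^~ t) (hinv ^~ t) /\ cancel (hinv ^~ t) (h ^~ t).

(* The quantities C(E_1(0)), C(c_0, E_1(0)), c_1 and c_2 of the existence
   theorem: they are fixed before any solution is considered. *)
Record wu_constants := {
  CE : R -> R;
  CcE : R -> R -> R;
  cst1 : R -> R;
  cst2 : R -> R;
  cst1_gt0 : forall e, 0 < cst1 e;
  cst2_gt0 : forall e, 0 < cst2 e }.

(* [sa_invdz], [sa_Psit], [sa_Za] and [sa_h] spell out what smoothness up to the
   boundary means for 1/Psi_z', Psi_t/Psi_z', 1/Z_{,alpha'} and the flow of b;
   in particular no quotient below has a vanishing denominator. *)
Record smooth_approx (T0 : R) (F0 Psi0 : C -> C) (eps : R)
    (F Psi : C -> R -> C) (P : C -> R -> R) (h hinv : R -> R -> R) : Prop := {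
  sa_F : smooth_clhp T0 F;
  sa_Psi : smooth_clhp T0 Psi;
  sa_P : smooth_clhp T0 (cplx P);
  sa_invdz : cont_on clhp T0 (fun z t => bext (invdz (Psi ^~ t)) z);
  sa_Psit : cont_on clhp T0
    (fun z t => bext (fun w => dt T0 Psi w t / dz (Psi ^~ t) w) z);
  sa_Za : forall a t, 0 <= t <= T0 -> Zaof Psi a t != 0;
  sa_system : water_wave T0 F Psi P;
  sa_F0 : forall z, clhp z -> F z 0 = F0 (z - eps *i);
  sa_Psi0 : forall z, clhp z -> Psi z 0 = Psi0 (z - eps *i);
  sa_h : smooth_line T0 (cplx h);
  sa_flow : forall a t, 0 <= t <= T0 ->
    has_deriv `[0, T0] (cplx h a) t (bof T0 F Psi (h a t) t);
  sa_flow0 : forall a, h a 0 = a;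
  sa_hinv : spatial_inverse T0 h hinv;
  sa_zt : forall a t, 0 <= t <= T0 -> dt T0 (zof Psi h) a t = Ztof F (h a t) t;
  sa_gradP : forall a t, 0 <= t <= T0 ->
    bext (fun z => invdz (Psi ^~ t) z * grad_conj (P ^~ t) z) a%:C
    = 'i * ((A1of F a t)%:C / Zaof Psi a t);
  sa_Ztt : forall a t, 0 <= t <= T0 ->
    (Zttof T0 (zof Psi h) hinv a t)^* - 'i
    = - 'i * ((A1of F a t)%:C / Zaof Psi a t);
  sa_pressure : pressure_formula T0 F P }.

(* Bounds at time t, for the values e = E_1(0) and c = c_0. *)
Record approx_bounds (K : wu_constants) (e c T0 : R)
    (F Psi : C -> R -> C) (h : R -> R -> R) (t : R) : Prop := {
  ab_Zta : (norm2 (Ztaof F ^~ t) <= (CE K e)%:E)%E;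
  ab_invZa : (norm2 (da (fun a s => (Zaof Psi a s)^-1)%R ^~ t) <= (CE K e)%:E)%E;
  ab_A1 : (norm_oo (cplx (A1of F) ^~ t) <= (CE K e)%:E)%E;
  ab_A1a : (norm2 (fun a => (Zaof Psi a t)^-1 * da (cplx (A1of F)) a t)%R
            <= (CE K e)%:E)%E;
  ab_ba : (norm_oo (da (bof T0 F Psi) ^~ t) <= (CE K e)%:E)%E;
  ab_hta : (norm_oo (fun a => da (dt T0 (cplx h)) a t / da (cplx h) a t)%R
            <= (CE K e)%:E)%E;
  ab_zta : (norm_oo (fun a => da (dt T0 (zof Psi h)) a t / da (zof Psi h) a t)%R
            <= (CE K e)%:E)%E;
  ab_ZZta : (norm2 (da (fun a s => (Zaof Psi a s ^+ 2)^-1 * Ztaof F a s)%R ^~ t)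
             <= (CE K e)%:E)%E;
  ab_ZZta_conj :
    (norm2 (da (fun a s => (Zaof Psi a s ^+ 2)^-1 * (Ztaof F a s)^*)%R ^~ t)
     <= (CE K e)%:E)%E;
  ab_Zt_invZa :
    (norm_oo (Ztof F ^~ t) + norm_oo (fun a => (Zaof Psi a t)^-1)%R
     <= (CcE K c e)%:E)%E;
  ab_ha : forall a,
    cst1 K e <= modulus (da (cplx h) a t) /\
    modulus (da (cplx h) a t) <= cst2 K e;
  ab_za : forall a,
    cst1 K e * modulus (da (zof Psi h) a 0) <= modulus (da (zof Psi h) a t) /\
    modulus (da (zof Psi h) a t) <= cst2 K e * modulus (da (zof Psi h) a 0);
  ab_zta_pt : forall a, modulus (da (dt T0 (zof Psi h)) a t)
    <= cst2 K e * modulus (da (zof Psi h) a 0) }.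

Definition cvg_cpt (X : topologicalType) (D : set X) (T0 : R) (V : uniformType)
    (Gn : nat -> X -> R -> V) (G : X -> R -> V) : Prop :=
  forall K : set (X * R), compact K -> K `<=` D `*` `[0, T0] ->
    {uniform K, (fun n (p : X * R) => Gn n p.1 p.2) @ \oo -->
                (fun p : X * R => G p.1 p.2)}.

Record approx_limit (K : wu_constants) (e T0 : R)
    (Fn Psin : nat -> C -> R -> C) (Pn : nat -> C -> R -> R)
    (hn hinvn : nat -> R -> R -> R)
    (F Psi : C -> R -> C) (P : C -> R -> R) (h hinv : R -> R -> R)
    (z : R -> R -> C) : Prop := {
  al_h_cont : cont_on setT T0 h;
  al_h_homeo : forall t, 0 <= t <= T0 ->
    continuous (h ^~ t) /\ continuous (hinv ^~ t);
  al_hinv : spatial_inverse T0 h hinv;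
  al_h0 : forall a, h a 0 = a;
  al_h : cvg_cpt setT T0 hn h;
  al_hinvn : cvg_cpt setT T0 hinvn hinv;
  al_h_lip : forall a b t, 0 <= t <= T0 -> a != b ->
    cst1 K e <= (h a t - h b t) / (a - b) /\ (h a t - h b t) / (a - b) <= cst2 K e;
  al_z_cont : cont_on setT T0 z;
  al_z_C2 : forall a t, 0 <= t <= T0 ->
    ex_deriv `[0, T0] (z a) t /\ ex_deriv `[0, T0] (dt T0 z a) t;
  al_zt_cont : cont_on setT T0 (dt T0 z);
  al_ztt_cont : cont_on setT T0 (dt T0 (dt T0 z));
  al_z_bounded : exists M : R, forall a t, 0 <= t <= T0 ->
    modulus (dt T0 z a t) <= M /\ modulus (dt T0 (dt T0 z) a t) <= M;
  al_z : cvg_cpt setT T0 (fun n => zof (Psin n) (hn n)) z;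
  al_zt : cvg_cpt setT T0 (fun n => dt T0 (zof (Psin n) (hn n))) (dt T0 z);
  al_ztt : cvg_cpt setT T0 (fun n => dt T0 (dt T0 (zof (Psin n) (hn n))))
                           (dt T0 (dt T0 z));
  al_Z : cvg_cpt setT T0 (fun n => Zof (Psin n)) (fun a t => z (hinv a t) t);
  al_Zt : cvg_cpt setT T0 (fun n => Ztof (Fn n))
                          (fun a t => dt T0 z (hinv a t) t);
  al_Ztt : cvg_cpt setT T0 (fun n => Zttof T0 (zof (Psin n) (hn n)) (hinvn n))
                           (Zttof T0 z hinv);
  al_Z_trace : forall (a t : R), 0 <= t <= T0 -> z (hinv a t) t = Psi a%:C t;
  al_Zt_trace : forall (a t : R), 0 <= t <= T0 ->
    (dt T0 z (hinv a t) t)^* = F a%:C t;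
  al_Psi : cvg_cpt clhp T0 Psin Psi;
  al_invdz : cvg_cpt clhp T0 (fun n w t => bext (invdz (Psin n ^~ t)) w)
                             (fun w t => bext (invdz (Psi ^~ t)) w);
  al_Psit_dz : cvg_cpt clhp T0
    (fun n w t => bext (fun v => dt T0 (Psin n) v t / dz (Psin n ^~ t) v) w)
    (fun w t => bext (fun v => dt T0 Psi v t / dz (Psi ^~ t) v) w);
  al_F : cvg_cpt clhp T0 Fn F;
  al_P : cvg_cpt clhp T0 Pn P;
  al_Psit : cvg_cpt lhp T0 (fun n => dt T0 (Psin n)) (dt T0 Psi);
  al_dPsi : cvg_cpt lhp T0 (fun n w t => dz (Psin n ^~ t) w)
                           (fun w t => dz (Psi ^~ t) w);
  al_dF : cvg_cpt lhp T0 (fun n w t => dz (Fn n ^~ t) w)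
                         (fun w t => dz (F ^~ t) w);
  al_Ft : cvg_cpt lhp T0 (fun n => dt T0 (Fn n)) (dt T0 F);
  al_gradP : cvg_cpt lhp T0 (fun n w t => grad_conj (Pn n ^~ t) w)
                            (fun w t => grad_conj (P ^~ t) w) }.

Record wu_solution (K : wu_constants) (T0 : R) (F Psi : C -> R -> C)
    (P : C -> R -> R) (h : R -> R -> R) : Prop := {
  ws_data : water_data (F ^~ 0) (Psi ^~ 0) (P ^~ 0);
  ws_system : water_wave T0 F Psi P;
  ws_Psi_C1 : C1_lhp_time T0 Psi;
  ws_Psi_cont : cont_on clhp T0 Psi;
  ws_invdz_cont : cont_on clhp T0 (fun z t => bext (invdz (Psi ^~ t)) z);
  ws_Psit_cont : cont_on clhp T0
    (fun z t => bext (fun w => dt T0 Psi w t / dz (Psi ^~ t) w) z);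
  ws_F_bounded : exists M : R, forall z t, clhp z -> 0 <= t <= T0 ->
    modulus (F z t) <= M;
  ws_F_cont : cont_on clhp T0 F;
  ws_F_C1 : C1_lhp_time T0 F;
  ws_P_cont : cont_on clhp T0 P;
  ws_P_C1 : C1_lhp_time T0 (cplx P);
  ws_energy : forall t, 0 <= t <= T0 -> (energy1 (F ^~ t) (Psi ^~ t) < +oo)%E;
  ws_c0 : forall t, 0 <= t <= T0 -> (c0 (F ^~ t) (Psi ^~ t) < +oo)%E;
  ws_approx :
    let e := fine (energy1 (F ^~ 0) (Psi ^~ 0)) in
    let c := fine (c0 (F ^~ 0) (Psi ^~ 0)) in
    exists (Fe Psie : R -> C -> R -> C) (Pe : R -> C -> R -> R)
           (he hinve : R -> R -> R -> R),
      [/\ forall eps, 0 < eps <= 1 ->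
            smooth_approx T0 (F ^~ 0) (Psi ^~ 0) eps
              (Fe eps) (Psie eps) (Pe eps) (he eps) (hinve eps),
          forall eps t, 0 < eps <= 1 -> 0 <= t <= T0 ->
            approx_bounds K e c T0 (Fe eps) (Psie eps) (he eps) t &
          exists (eps_ : nat -> R) (hinv : R -> R -> R) (z : R -> R -> C),
            [/\ forall n, 0 < eps_ n <= 1,
                eps_ n @[n --> \oo] --> 0 &
                approx_limit K e T0
                  (fun n => Fe (eps_ n)) (fun n => Psie (eps_ n))
                  (fun n => Pe (eps_ n)) (fun n => he (eps_ n))
                  (fun n => hinve (eps_ n)) F Psi P h hinv z]];
  ws_pressure : pressure_formula T0 F P }.

Definition singular_set (Psi : C -> R -> C) (t : R) : set R :=
  [set a | bext (invdz (Psi ^~ t)) a%:C = 0].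

(* Z_{,alpha'} / |Z_{,alpha'}|, meaningful off the singular set; near an
   isolated singular point that is the whole punctured neighbourhood. *)
Definition tangent (Psi : C -> R -> C) (a t : R) : C :=
  Zaof Psi a t / `|Zaof Psi a t|.

End HalfPlane.

(* Main.v *)
(* Write [w = 1/Psi_z'], [g = Z_{t,alpha'} / Z_{,alpha'}] and
   [q = w^2 Z_{t,alpha'} = w g] on the boundary, for one of the smooth
   approximations.  The tangent direction of [Z] at the particle [h(alpha,t)]
   rotates at the rate [Im g], so it suffices that [g] is small near a singular
   particle.  By the uniform bounds [w] and [q] are Hoelder continuous of
   exponent 1/2 and [Z_{t,alpha'}] is bounded in [L^2].  If [|g(x)| >= delta] then
   [|Z_{t,alpha'}|] is at least a multiple of [delta/|w(x)|] on an interval around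
   [x] of length comparable to [|w(x)|^2], which costs an energy depending only on
   [delta].  Near a zero [x0] of [w], [|w(x)|^2] is at most of order [|x - x0|], so
   these intervals are disjoint for points [x] approaching [x0] geometrically:
   at each time, all but a bounded number of such points have [|g| < delta].
   Integrating in time, the average rotation of [m] such particles is small for
   large [m], uniformly in the approximation.  Hence in the limit there cannot be
   particles arbitrarily close to a singular one that rotate by a fixed amount.
   The singular set is carried by the flow because [|w(h(alpha,t),t)|] and
   [|w(alpha,0)|] are comparable. *)
Require Import Defs.
From HB Require Import structures.
From mathcomp Require Import all_boot all_order all_algebra.
From mathcomp Require Import complex.
From mathcomp Require Import all_classical all_reals all_analysis.
From mathcomp Require Import measurable_realfun ring lra.

Set Implicit Arguments.
Unset Strict Implicit.
Unset Printing Implicit Defensive.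

Import Order.TTheory GRing.Theory Num.Theory.
Import numFieldNormedType.Exports.

Local Open Scope classical_set_scope.
Local Open Scope ring_scope.
Local Open Scope complex_scope.

(** * Complex numbers and complex-valued functions of a real variable *)

Section Modulus.
Variable R : realType.
Local Notation C := R[i].
Implicit Types z w : C.

Lemma normCE z : `|z| = (modulus z)%:C.
Proof. by case: z. Qed.

Lemma modulus_ge0 z : 0 <= modulus z.
Proof. by case: z => a b; rewrite /modulus /= sqrtr_ge0. Qed.

Lemma modulus0 : modulus (0 : C) = 0.
Proof. exact: Normc.normc0. Qed.

Lemma modulus_eq0 z : (modulus z == 0) = (z == 0).
Proof.
apply/eqP/eqP => [|->]; last exact: modulus0.
exact: Normc.eq0_normc.
Qed.

Lemma modulus_gt0 z : (0 < modulus z) = (z != 0).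
Proof. by rewrite lt_def modulus_eq0 modulus_ge0 andbT. Qed.

Lemma modulusM z w : modulus (z * w) = modulus z * modulus w.
Proof. exact: Normc.normcM. Qed.

Lemma modulusV z : modulus z^-1 = (modulus z)^-1.
Proof. exact: Normc.normcV. Qed.

Lemma modulusN z : modulus (- z) = modulus z.
Proof. exact: complex.normcN. Qed.

Lemma modulusX z n : modulus (z ^+ n) = modulus z ^+ n.
Proof.
elim: n => [|n IH]; first by rewrite !expr0 /modulus Normc.normc1.
by rewrite !exprS modulusM IH.
Qed.

Lemma ler_modulusD z w : modulus (z + w) <= modulus z + modulus w.
Proof. exact: complex.le_normcD. Qed.

Lemma modulusBC z w : modulus (z - w) = modulus (w - z).
Proof. by rewrite -modulusN opprB. Qed.

Lemma lerB_modulus z w : modulus z - modulus w <= modulus (z - w).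
Proof. by rewrite lerBlDr -{1}(subrK w z) ler_modulusD. Qed.

Lemma ler_modulus_dist y z w : modulus (z - w) <= modulus (z - y) + modulus (y - w).
Proof. by rewrite -[X in modulus X <= _](subrKA y) ler_modulusD. Qed.

Lemma modulusR (x : R) : modulus x%:C = `|x|.
Proof. by rewrite /modulus /= expr0n addr0 sqrtr_sqr. Qed.

Lemma modulus_conj z : modulus (z^*)%C = modulus z.
Proof. by case: z => a b; rewrite /modulus /= sqrrN. Qed.

Lemma normr_Re z : `|complex.Re z| <= modulus z.
Proof.
case: z => a b /=; rewrite /modulus /= -[`|a|]sqrtr_sqr ler_wsqrtr //.
by rewrite lerDl sqr_ge0.
Qed.

Lemma normr_Im z : `|complex.Im z| <= modulus z.
Proof.
case: z => a b /=; rewrite /modulus /= -[`|b|]sqrtr_sqr ler_wsqrtr //.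
by rewrite lerDr sqr_ge0.
Qed.

Lemma sqr_modulus z : modulus z ^+ 2 = complex.Re z ^+ 2 + complex.Im z ^+ 2.
Proof. by case: z => a b; rewrite /modulus /= sqr_sqrtr// addr_ge0// sqr_ge0. Qed.

(** The norm of [R[i]] takes its values in [R[i]]. A positive element there has zero imaginary part,
    so tolerances can be taken in [R]. *)
Lemma cvgC_modulus (T : Type) (F : set_system T) {FF : Filter F} (f : T -> C) (l : C) :
  f @ F --> l <-> (forall e : R, 0 < e -> \forall x \near F, modulus (f x - l) < e).
Proof.
split=> [fl e e0|H].
  have e0' : 0 < e%:C by rewrite ltcR.
  have /cvgrPdist_lt/(_ _ e0') := fl; apply: filterS => x.
  by rewrite normCE ltcR modulusBC.
apply/cvgrPdist_lt => -[e1 e2]; rewrite ltcE /= => /andP[/eqP -> e0].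
by apply: filterS (H _ e0) => x; rewrite -ltcR modulusBC -normCE.
Qed.

Lemma cvgDC (T : Type) (F : set_system T) {FF : Filter F} (f g : T -> C) (a b : C) :
  f @ F --> a -> g @ F --> b -> (fun x => f x + g x) @ F --> a + b.
Proof. by move=> fa gb; exact: (@cvgD _ _ T F FF f g a b fa gb). Qed.

Lemma cvgMC (T : Type) (F : set_system T) {FF : Filter F} (f g : T -> C) (a b : C) :
  f @ F --> a -> g @ F --> b -> (fun x => f x * g x) @ F --> a * b.
Proof. by move=> fa gb; exact: (@cvgM C T F FF f g a b fa gb). Qed.

Lemma cvgVC (T : Type) (F : set_system T) {FF : Filter F} (f : T -> C) (a : C) :
  a != 0 -> f @ F --> a -> (fun x => (f x)^-1) @ F --> a^-1.
Proof. by move=> a0 fa; exact: (@cvgV C T F FF f a a0 fa). Qed.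

Lemma ler_norm_between (a b x : R) :
  Num.min a b <= x <= Num.max a b -> `|x - a| <= `|b - a|.
Proof.
case: (leP a b) => ab /andP[ax xb].
  by rewrite !ger0_norm ?subr_ge0// lerB.
by rewrite !ler0_norm ?subr_le0// ?(ltW ab)// lerN2 lerB.
Qed.

Lemma cvg_modulus (T : Type) (F : set_system T) {FF : Filter F} (f : T -> C) (l : C) :
  f @ F --> l -> modulus (f t) @[t --> F] --> modulus l.
Proof.
move=> /cvgC_modulus H; apply/cvgrPdist_lt => d d0; apply: filterS (H _ d0) => n.
apply: le_lt_trans; rewrite distrC ler_norml lerB_modulus andbT.
by rewrite lerNl opprB modulusBC lerB_modulus.
Qed.

(** The difference of inverses is [(w - z) / (z w)]. The first term of the minimum keeps [|z|] above
    [|w| / 2], and the second then bounds the quotient. *)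
Lemma modulus_inv_dist (z w : C) (d : R) : w != 0 ->
  modulus (z - w) < Num.min (modulus w / 2) (d * modulus w ^+ 2 / 2) ->
  modulus (z^-1 - w^-1) <= d.
Proof.
move=> wn0; rewrite lt_min => /andP[zw1 zw2].
have w0 : 0 < modulus w by rewrite modulus_gt0.
have z2 : modulus w / 2 <= modulus z.
  by have := lerB_modulus w z; rewrite modulusBC; lra.
have z0 : 0 < modulus z by lra.
have zn0 : z != 0 by rewrite -modulus_gt0.
have -> : z^-1 - w^-1 = - (z - w) * z^-1 * w^-1.
  by field; rewrite wn0 zn0.
rewrite !modulusM !modulusV modulusN !ler_pdivrMr//.
apply: le_trans (ltW zw2) _.
have d0 : 0 <= d.
  have := le_lt_trans (modulus_ge0 _) zw2.
  by rewrite pmulr_lgt0// => /ltW; rewrite pmulr_lge0// exprn_gt0.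
have := ler_wpM2l (mulr_ge0 d0 (ltW w0)) z2.
by move: (modulus _) (modulus _) => A B; lra.
Qed.

End Modulus.

(** * Derivatives relative to a subset of the line, and the mean value inequality *)

Section Derivatives.
Variable R : realType.
Local Notation C := R[i].
Implicit Types (A : set R) (f g : R -> C) (x y : R) (l z w : C).

Lemma near_within_dnbhsP A x (P : R -> Prop) :
  (\forall y \near within A x^', P y) <->
  exists2 d, 0 < d & forall y, A y -> y != x -> `|y - x| < d -> P y.
Proof.
split.
  move=> /nbhs_ballP[d /= d0 H]; exists d => // y Ay yx yd.
  by apply: H => //; rewrite /ball /= distrC.
move=> [d d0 H]; apply/nbhs_ballP; exists d => //= y; rewrite /ball /= => yd yx Ay.
by apply: H => //; rewrite distrC.
Qed.

(** The first-order expansion avoids division and includes the point [y = x], which makes chain and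
    product estimates direct. *)
Lemma has_derivP A f x l : has_deriv A f x l <->
  forall e : R, 0 < e -> exists2 d, 0 < d & forall y, A y -> `|y - x| < d ->
    modulus (f y - f x - l * (y - x)%:C) <= e * `|y - x|.
Proof.
have E y : y != x -> f y - f x - l * (y - x)%:C =
    (diff_quot f x y - l) * (y - x)%:C.
  move=> yx; rewrite mulrBl /diff_quot mulfVK//.
  by rewrite -modulus_gt0 modulusR normr_gt0 subr_eq0.
rewrite /has_deriv cvgC_modulus; split=> H e e0.
  have /near_within_dnbhsP[d d0 Hd] := H _ e0.
  exists d => // y Ay yd; have [->|yx] := eqVneq y x.
    by rewrite !subrr mulr0 subrr modulus0 normr0 mulr0.
  by rewrite E // modulusM modulusR ler_wpM2r// ltW// Hd.
have [|d d0 Hd] := H (e / 2); first by rewrite divr_gt0.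
apply/near_within_dnbhsP; exists d => // y Ay yx yd.
have /= := Hd y Ay yd.
rewrite E // modulusM modulusR ler_pM2r ?normr_gt0 ?subr_eq0// => /le_lt_trans; apply.
lra.
Qed.

Lemma has_deriv_cont A f x l (e : R) : has_deriv A f x l -> 0 < e ->
  exists2 d, 0 < d & forall y, A y -> `|y - x| < d -> modulus (f y - f x) < e.
Proof.
move=> /has_derivP/(_ _ ltr01)[d d0 Hd] e0.
have l0 := modulus_ge0 l.
have l1 : 0 < modulus l + 2 by lra.
exists (Num.min d (e / (modulus l + 2))).
  by rewrite lt_min d0 divr_gt0.
move=> y Ay; rewrite lt_min => /andP[yd]; rewrite ltr_pdivlMr// => ye.
have {}Hd := Hd y Ay yd.
have H : modulus (f y - f x) <= (1 + modulus l) * `|y - x|.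
  rewrite -{1}(subrK (l * (y - x)%:C) (f y - f x)).
  by rewrite (le_trans (ler_modulusD _ _))// modulusM modulusR mulrDl lerD.
have := normr_ge0 (y - x); nra.
Qed.

Lemma has_deriv_cvg A f x l : has_deriv A f x l ->
  f y @[y --> within A x^'] --> f x.
Proof.
move=> fl; apply/cvgC_modulus => e e0; apply/near_within_dnbhsP.
have [d d0 H] := has_deriv_cont fl e0; exists d => // y Ay _; exact: H.
Qed.

Lemma has_derivM A f g x l m : has_deriv A f x l -> has_deriv A g x m ->
  has_deriv A (fun y => f y * g y) x (l * g x + f x * m).
Proof.
move=> fl gm; rewrite /has_deriv.
have -> : diff_quot (fun y => f y * g y) x =
    (fun y => diff_quot f x y * g y + f x * diff_quot g x y).
  by apply/funext => y; rewrite /diff_quot; ring.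
have gc := has_deriv_cvg gm.
have fc : f x @[y --> within A x^'] --> f x by exact: cvg_cst.
exact: (cvgDC (cvgMC fl gc) (cvgMC fc gm)).
Qed.

Lemma has_derivD A f g x l m : has_deriv A f x l -> has_deriv A g x m ->
  has_deriv A (fun y => f y + g y) x (l + m).
Proof.
move=> fl gm; rewrite /has_deriv.
have -> : diff_quot (fun y => f y + g y) x =
    (fun y => diff_quot f x y + diff_quot g x y).
  by apply/funext => y; rewrite /diff_quot; ring.
exact: (cvgDC fl gm).
Qed.

Lemma has_deriv_eq_on A f g x l : (forall y, A y -> f y = g y) -> A x ->
  has_deriv A f x l -> has_deriv A g x l.
Proof.
move=> fg Ax /has_derivP H; apply/has_derivP => e /H[d d0 {}H]; exists d => // y Ay yd.
by rewrite -!fg// H.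
Qed.

Lemma has_derivV A f x l : (forall y, f y != 0) -> has_deriv A f x l ->
  has_deriv A (fun y => (f y)^-1) x (- l / f x ^+ 2).
Proof.
move=> f0 fl; rewrite /has_deriv.
have -> : diff_quot (fun y => (f y)^-1) x =
    (fun y => diff_quot f x y * (f y)^-1 * (- (f x)^-1)).
  apply/funext => y; rewrite /diff_quot.
  have -> : (f y)^-1 - (f x)^-1 = - (f y - f x) * (f y)^-1 * (f x)^-1.
    by field; rewrite !f0.
  by ring.
have -> : - l / f x ^+ 2 = l * (f x)^-1 * (- (f x)^-1) by field; rewrite f0.
have c : - (f x)^-1 @[y --> within A x^'] --> - (f x)^-1 by exact: cvg_cst.
exact: (cvgMC (cvgMC fl (cvgVC (f0 x) (has_deriv_cvg fl))) c).
Qed.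

Lemma has_deriv_conj A f x l : has_deriv A f x l ->
  has_deriv A (fun y => (f y)^*)%C x (l^*)%C.
Proof.
move=> /has_derivP H; apply/has_derivP => e /H[d d0 {}H]; exists d => // y Ay yd.
have -> : ((f y)^* - (f x)^* - l^* * (y - x)%:C)%C =
    ((f y - f x - l * (y - x)%:C)^*)%C.
  case: (f y) (f x) (l) => [a1 a2] [b1 b2] [c1 c2].
  by apply/eqP; rewrite eq_complex /=; apply/andP; split; apply/eqP; ring.
by rewrite modulus_conj H.
Qed.

(** The projections [Re (u * f)] carry complex-valued functions to real ones, where the real mean
    value and fundamental theorems apply. The factor [u] selects the direction of projection. *)
Lemma has_deriv_is_derive A f x l u : nbhs x A -> has_deriv A f x l ->
  is_derive x (1 : R) (fun y => complex.Re (u * f y)) (complex.Re (u * l)).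
Proof.
move=> /nbhs_ballP[r /= r0 Ar] /has_derivP H.
suff K : h^-1 *: (((fun y => complex.Re (u * f y)) \o shift x) (h *: 1) -
            complex.Re (u * f x)) @[h --> 0^'] --> complex.Re (u * l).
  by apply: DeriveDef; [apply/cvg_ex; exists (complex.Re (u * l)) | exact: cvg_lim].
apply/cvgrPdist_le => e e0.
have u0 := modulus_ge0 u.
have [|d d0 Hd] := H (e / (modulus u + 1)); first by rewrite divr_gt0// ltr_wpDl.
have m0 : 0 < Num.min d r by rewrite lt_min d0.
apply/nbhs_ballP; exists (Num.min d r) => //= h.
rewrite /ball /= sub0r normrN lt_min => /andP[hd hr] h0.
rewrite /GRing.scale /= mulr1.
have Ahx : A (h + x) by apply: Ar; rewrite /ball /= opprD addrCA subrr addr0 normrN.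
have := Hd _ Ahx; rewrite addrK => /(_ hd) B.
have E : complex.Re (u * l) - h^-1 * (complex.Re (u * f (h + x)) - complex.Re (u * f x))
   = - h^-1 * complex.Re (u * (f (h + x) - f x - l * h%:C)).
  case: (u) (l) (f x) (f (h + x)) => [u1 u2] [l1 l2] [a1 a2] [b1 b2] /=; field.
  exact: h0.
rewrite E normrM normrN normfV mulrC ler_pdivrMr ?normr_gt0//.
apply: le_trans (normr_Re _) _; rewrite modulusM.
apply: le_trans (ler_wpM2l u0 B) _.
rewrite mulrA ler_wpM2r// mulrCA ger_pMr// ler_pdivrMr; lra.
Qed.

Lemma proper_within_dnbhs A x :
  (forall d, 0 < d -> exists y, [/\ A y, y != x & `|y - x| < d]) ->
  ProperFilter (within A x^').
Proof.
move=> HA; split; last exact: within_filter.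
move=> /near_within_dnbhsP[d d0 H]; have [y [Ay yx yd]] := HA _ d0.
exact: H Ay yx yd.
Qed.

Lemma proper_dnbhs_setT x : ProperFilter (within setT x^').
Proof.
apply: proper_within_dnbhs => d d0; exists (x + d / 2); split => //.
  by rewrite addrC -subr_eq0 addrK gt_eqF// divr_gt0.
by rewrite addrAC subrr add0r gtr0_norm ?divr_gt0//; lra.
Qed.

(** A point in the left half of the interval has room on its right, and conversely. Hence
    derivatives in time are unique, also at the end points. *)
Lemma proper_dnbhs_itv (T0 : R) x : 0 < T0 -> 0 <= x <= T0 ->
  ProperFilter (within `[0, T0] x^').
Proof.
move=> T00 x0; apply: proper_within_dnbhs => d d0.
have m0 : 0 < Num.min (d / 2) (T0 / 2) by rewrite lt_min !divr_gt0.
have m1 : Num.min (d / 2) (T0 / 2) <= d / 2 by rewrite ge_min lexx.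
have m2 : Num.min (d / 2) (T0 / 2) <= T0 / 2 by rewrite ge_min lexx orbT.
set m := Num.min _ _ in m0 m1 m2 *.
have [xT|xT] := leP x (T0 / 2).
  exists (x + m); split.
  - by rewrite /= in_itv /=; lra.
  - by rewrite gt_eqF //; lra.
  - by rewrite ger0_norm; lra.
exists (x - m); split.
- by rewrite /= in_itv /=; lra.
- by rewrite lt_eqF //; lra.
- by rewrite ler0_norm; lra.
Qed.

Lemma deriv_setT f x l : has_deriv setT f x l -> Defs.deriv setT f x = l.
Proof.
move=> H; have ? := proper_dnbhs_setT x.
by apply: cvg_lim => //; exact: norm_hausdorff.
Qed.

Lemma deriv_itv (T0 : R) f x l : 0 < T0 -> 0 <= x <= T0 ->
  has_deriv `[0, T0] f x l -> Defs.deriv `[0, T0] f x = l.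
Proof.
move=> T00 x0 H; have ? := proper_dnbhs_itv T00 x0.
by apply: cvg_lim => //; exact: norm_hausdorff.
Qed.

(* Rotating by the conjugate of the increment reduces this to the real mean
   value theorem. *)
Lemma mean_value_le f f' (a b : R) l (e : R) :
  (forall x, Num.min a b <= x <= Num.max a b -> has_deriv setT f x (f' x)) ->
  (forall x, Num.min a b <= x <= Num.max a b -> modulus (f' x - l) <= e) ->
  modulus (f b - f a - l * (b - a)%:C) <= e * `|b - a|.
Proof.
wlog ab : a b / a <= b => [H df fl|].
  have [ab|/ltW ba] := leP a b; first exact: H.
  have := H b a ba; rewrite minC maxC => /(_ df fl).
  rewrite distrC; congr (_ <= _); rewrite -modulusN; congr (modulus _).
  by rewrite -[(b - a)]opprB rmorphN; ring.
rewrite min_l// max_r// => df fl.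
set v := _ - _ - _; have [v0|v0] := eqVneq v 0.
  by rewrite v0 modulus0 mulr_ge0// (le_trans _ (fl a _))// ?modulus_ge0 ?lexx.
pose F x := complex.Re ((v^*)%C * f x) - complex.Re ((v^*)%C * l) * x.
pose F' x := complex.Re ((v^*)%C * f' x) - complex.Re ((v^*)%C * l).
have dF x : x \in `]a, b[%R -> is_derive x (1 : R) F (F' x).
  rewrite in_itv /= => /andP[ax xb].
  have /(has_deriv_is_derive (v^*)%C filterT) H : has_deriv setT f x (f' x).
    by apply: df; rewrite !ltW.
  rewrite /F /F'; apply: is_deriveB.
  by rewrite -[X in is_derive _ _ _ X]mulr1; exact: is_deriveZ.
have cF : {within `[a, b], continuous F}.
  apply: derivable_within_continuous => x; rewrite in_itv /= => xab.
  have /(has_deriv_is_derive (v^*)%C filterT) H := df x xab.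
  by apply: derivableB; [exact: ex_derive|exact: derivableZ].
have [c cab E] := MVT_segment ab dF cF.
have vv : modulus v ^+ 2 = F b - F a.
  rewrite sqr_modulus /F /v.
  case: (f a) (f b) (l) => [a1 a2] [b1 b2] [c1 c2] /=; ring.
have Fc : F' c <= modulus v * e.
  have -> : F' c = complex.Re ((v^*)%C * (f' c - l)).
    rewrite /F'; case: (v^*)%C (f' c) (l) => [a1 a2] [b1 b2] [c1 c2] /=; ring.
  apply: le_trans (ler_norm _) _; apply: le_trans (normr_Re _) _.
  rewrite modulusM modulus_conj ler_wpM2l ?modulus_ge0//.
  by apply: fl; rewrite in_itv in cab.
have v0' : 0 < modulus v by rewrite modulus_gt0.
rewrite -(ler_pM2l v0') -expr2 vv E mulrA ger0_norm ?subr_ge0//.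
by rewrite ler_wpM2r ?subr_ge0.
Qed.

End Derivatives.

(** * Energy estimates *)

Section SquareIntegrable.
Variable R : realType.
Local Notation C := R[i].
Local Notation mu := (@lebesgue_measure R).
Implicit Types (f g : R -> C) (x y : R).

Lemma continuous_modulus f : continuous f -> continuous (fun x => modulus (f x)).
Proof.
move=> cf x; apply/cvgrPdist_lt => e e0.
have /cvgC_modulus/(_ _ e0) := cf x; apply: filterS => y.
apply: le_lt_trans; rewrite distrC ler_norml lerB_modulus andbT.
by rewrite lerNl opprB modulusBC lerB_modulus.
Qed.

Lemma continuous_sqr_modulus f :
  continuous f -> continuous (fun x => modulus (f x) ^+ 2).
Proof. by move=> /continuous_modulus cf x; apply: cvgM; exact: cf. Qed.

Lemma measurable_sqr_modulus (D : set R) f : continuous f -> measurable D ->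
  measurable_fun D (fun x => (modulus (f x) ^+ 2)%:E).
Proof.
move=> cf mD; apply/measurable_EFinP; apply: measurable_funS (@subsetT _ D) _ => //.
by apply: continuous_measurable_fun; exact: continuous_sqr_modulus.
Qed.

Lemma norm2_le f (c : R) : 0 <= c -> (norm2 f <= c%:E)%E ->
  (\int[mu]_x (modulus (f x) ^+ 2)%:E <= (c ^+ 2)%:E)%E.
Proof.
move=> c0; rewrite /norm2 unlock /=.
have E x : `|modulus (f x)| `^ 2 = modulus (f x) ^+ 2.
  by rewrite ger0_norm ?modulus_ge0// powR_mulrn ?modulus_ge0.
under eq_integral => x _ do rewrite E.
have : (0 <= \int[mu]_x (modulus (f x) ^+ 2)%:E)%E.
  by apply: integral_ge0 => x _; rewrite lee_fin sqr_ge0.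
case: (\int[mu]_x _)%E => //= [r|].
  rewrite !lee_fin => r0; rewrite powR12_sqrt // => rc.
  by rewrite -[r]sqr_sqrtr// ler_pXn2r// ?nnegrE ?sqrtr_ge0.
(* An infinite integral would have an infinite square root, against the finite bound. *)
by rewrite invr_eq0 pnatr_eq0 /=.
Qed.

(** A Chebyshev count: each ball contributes at least [2 * L i * d ^+ 2], hence at least [kap], to
    the integral of [|f|^2], and disjointness lets the contributions add up. *)
Lemma norm2_ball_card f (c kap : R) (I : finType) (A : {set I}) (x L : I -> R) :
  continuous f -> 0 <= c -> (norm2 f <= c%:E)%E ->
  (forall i, i \in A -> 0 <= L i) ->
  (forall i j z, i \in A -> j \in A -> `|z - x i| < L i -> `|z - x j| < L j -> i = j) ->
  (forall i, i \in A -> exists2 d, 0 <= d & kap <= 2 * L i * d ^+ 2 /\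
     forall z, `|z - x i| < L i -> d <= modulus (f z)) ->
  #|A|%:R * kap <= c ^+ 2.
Proof.
move=> cf c0 fc L0 disj low; rewrite -lee_fin.
apply: le_trans (norm2_le c0 fc).
have mB i : measurable (ball (x i) (L i) : set R) by exact: measurable_ball.
pose D := \big[setU/set0]_(i <- enum A) (ball (x i) (L i) : set R).
have mD : measurable D by apply: bigsetU_measurable.
apply: (@le_trans _ _ (\int[mu]_(x in D) (modulus (f x) ^+ 2)%:E)%E); last first.
  apply: ge0_subset_integral => //; first exact: measurable_sqr_modulus.
  by move=> z _; rewrite lee_fin sqr_ge0.
rewrite ge0_integral_bigsetU//=; first last.
- by move=> z _; rewrite lee_fin sqr_ge0.
- exact: measurable_sqr_modulus.
- move=> i j /=; rewrite !mem_enum => iA jA [z [zi zj]].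
  by apply: (disj i j z) => //; rewrite distrC.
- exact: enum_uniq.
have -> : (#|A|%:R * kap)%:E = (\sum_(i <- enum A) kap%:E)%E.
  by rewrite sumEFin big_const_seq count_predT iter_addr addr0 -cardE mulr_natl.
rewrite big_seq [X in (_ <= X)%E]big_seq; apply: lee_sum => i; rewrite mem_enum => iA.
have [d d0 [kd fd]] := low i iA.
apply: (@le_trans _ _ (\int[mu]_(x in ball (x i) (L i)) (d ^+ 2)%:E)%E).
  have -> : (\int[mu]_(x in ball (x i) (L i)) (d ^+ 2)%:E =
      (d ^+ 2)%:E * mu (ball (x i) (L i)))%E.
    by rewrite -integral_cst; last exact: mB.
  have -> := lebesgue_measure_ball (x i) (L0 i iA); rewrite -EFinM lee_fin.
  by have -> : d ^+ 2 * (L i *+ 2) = 2 * L i * d ^+ 2 by ring.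
apply: ge0_le_integral => //; first exact: mB.
- by move=> z _; rewrite lee_fin sqr_ge0.
- exact: measurable_sqr_modulus.
- move=> z zi; rewrite lee_fin ler_pXn2r// ?nnegrE ?modulus_ge0//.
  by apply: fd; rewrite distrC.
Qed.

(* Integrate the pointwise bound [|f'| <= lam |f'|^2 / 2 + 1 / (2 lam)] with
   [lam = sqrt |y - x| / c]. *)
Lemma norm2_holder f f' (c : R) : (forall x, has_deriv setT f x (f' x)) ->
  continuous f' -> 0 < c -> (norm2 f' <= c%:E)%E ->
  forall x y, modulus (f y - f x) <= c * Num.sqrt `|y - x|.
Proof.
move=> df cf' c0 fc x y.
wlog xy : x y / x < y => [H|].
  have [|yx|->] := ltgtP x y; first exact: H.
    by rewrite modulusBC distrC H.
  by rewrite !subrr modulus0 normr0 sqrtr0 mulr0.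
rewrite gtr0_norm ?subr_gt0//.
set v := f y - f x; have [v0|v0] := eqVneq v 0.
  by rewrite v0 modulus0 mulr_ge0// ?sqrtr_ge0// ltW.
have {}v0 : 0 < modulus v by rewrite modulus_gt0.
set s := Num.sqrt (y - x).
have s0 : 0 < s by rewrite sqrtr_gt0 subr_gt0.
have s2 : s ^+ 2 = y - x by rewrite sqr_sqrtr ?subr_ge0// ltW.
pose lam := s / c; have lam0 : 0 < lam by rewrite divr_gt0.
(* The increment of [F] from [x] to [y] is exactly [|v|^2], so only a real integral has to be
   estimated. *)
pose F z := complex.Re ((v^*)%C * f z).
pose F' z := complex.Re ((v^*)%C * f' z).
have dF z : is_derive z (1 : R) F (F' z).
  exact: (has_deriv_is_derive (v^*)%C filterT (df z)).
have cF' : continuous F'.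
  move=> z; apply/cvgrPdist_lt => e e0.
  have /cvgC_modulus/(_ (e / modulus v)) := cf' z.
  rewrite divr_gt0// => /(_ isT); apply: filterS => w; rewrite ltr_pdivlMr// => H.
  apply: le_lt_trans H; rewrite mulrC -(modulus_conj v) -modulusM mulrBr.
  rewrite distrC; apply: le_trans (normr_Re _).
  by rewrite /F'; case: (_ * _) (_ * _) => [a1 a2] [b1 b2].
pose p z := modulus (f' z) ^+ 2.
have cp : continuous p by exact: continuous_sqr_modulus.
have ip (h : R -> R) : continuous h -> mu.-integrable `[x, y] (EFin \o h).
  move=> ch; apply: continuous_compact_integrable; first exact: segment_compact.
  by apply: continuous_subspaceT.
have mI : measurable (`[x, y]%classic : set R) by [].
have FE : \int[mu]_(z in `[x, y]) F' z = modulus v ^+ 2.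
  rewrite /Rintegral (@continuous_FTC2 _ F' F)//=.
  - rewrite /F sqr_modulus /v; case: (f x) (f y) => [a1 a2] [b1 b2] /=; ring.
  - exact: continuous_subspaceT.
  - have cF z : F z @[z --> z] --> F z.
      apply: differentiable_continuous; apply/derivable1_diffP; exact: ex_derive.
    by split=> [z _|//|//]; [exact: ex_derive|apply: cvg_at_right_filter; exact: cF|
       apply: cvg_at_left_filter; exact: cF].
  - by move=> z _; rewrite derive1E derive_val.
have pC : \int[mu]_(z in `[x, y]) p z <= c ^+ 2.
  rewrite -lee_fin /Rintegral fineK; last exact: integrable_fin_num (ip _ cp).
  apply: le_trans (norm2_le (ltW c0) fc).
  apply: ge0_subset_integral => //; first exact: measurable_sqr_modulus.
  by move=> z _; rewrite lee_fin sqr_ge0.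
have le1 : \int[mu]_(z in `[x, y]) F' z <=
    \int[mu]_(z in `[x, y]) (modulus v * lam / 2 * p z + modulus v / (2 * lam)).
  apply: le_Rintegral => //.
  - exact: ip.
  - apply: (ip (fun z => modulus v * lam / 2 * p z + modulus v / (2 * lam))) => z.
    apply: cvgD; last exact: cvg_cst.
    by apply: cvgM; [exact: cvg_cst|exact: cp].
  - move=> z _; apply: le_trans (ler_norm _) _; apply: le_trans (normr_Re _) _.
    have -> : modulus v * lam / 2 * p z + modulus v / (2 * lam) =
        modulus v * (lam / 2 * p z + (2 * lam)^-1) by field; rewrite gt_eqF.
    rewrite modulusM modulus_conj ler_wpM2l ?modulus_ge0//.
    rewrite /p; set q := modulus (f' z).
    (* Completing the square proves the pointwise bound. *)
    have -> : lam / 2 * q ^+ 2 + (2 * lam)^-1 = q + lam / 2 * (q - lam^-1) ^+ 2.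
      by field; rewrite gt_eqF.
    by rewrite lerDl mulr_ge0 ?sqr_ge0// divr_ge0// ltW.
rewrite FE RintegralD//= in le1; last 2 first.
- apply: (ip (fun z => modulus v * lam / 2 * p z)) => z.
  by apply: cvgM; [exact: cvg_cst|exact: cp].
- by apply: (ip (fun z => modulus v / (2 * lam))) => z; exact: cvg_cst.
rewrite RintegralZl//= in le1; last exact: ip.
rewrite Rintegral_cst//= lebesgue_measure_itv/= lte_fin xy /= in le1.
have le2 : modulus v ^+ 2 <= modulus v * (c * s).
  apply: le_trans le1 _; rewrite -s2 /lam.
  (* With this [lam] both terms equal half of [modulus v * c * s]. *)
  apply: (@le_trans _ _ (modulus v * (s / c) / 2 * c ^+ 2 +
     modulus v / (2 * (s / c)) * s ^+ 2)).
    by rewrite lerD2r ler_wpM2l// !mulr_ge0 ?invr_ge0 ?modulus_ge0// ltW.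
  by rewrite le_eqVlt; apply/orP; left; apply/eqP; field; rewrite !gt_eqF.
by rewrite expr2 ler_pM2l in le2.
Qed.

End SquareIntegrable.

(** * Few points of a geometric sequence can carry a large strain *)

Section Concentration.
Variable R : realType.
Local Notation C := R[i].
Implicit Types (w phi : R -> C).

(* If [phi * w] is at least [del] in modulus at [x i], then by Hoelder continuity
   [w] and [phi * w ^+ 2] are almost constant on the ball of radius
   [(|w (x i)| / k)^2], on which [phi] therefore carries an amount of energy
   depending only on [c] and [del].  These balls are disjoint. *)
Lemma sum_strain_le w phi (c G del : R) (m : nat) (x : 'I_m -> R) (x0 : R) :
  0 < c -> 0 < del -> 0 <= G -> continuous phi -> (norm2 phi <= c%:E)%E ->
  (forall y, w y != 0) ->
  (forall y z, modulus (w z - w y) <= c * Num.sqrt `|z - y|) ->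
  (forall y z, modulus (phi z * w z ^+ 2 - phi y * w y ^+ 2) <=
     c * Num.sqrt `|z - y|) ->
  (forall i j : 'I_m, (i < j)%N -> `|x j - x0| <= `|x i - x0| / 2) ->
  (forall i, x i != x0) ->
  (forall i, modulus (w x0) <= c * Num.sqrt `|x i - x0|) ->
  (forall i, modulus (phi (x i) * w (x i)) <= G) ->
  \sum_i modulus (phi (x i) * w (x i)) <=
    c ^+ 2 * (81 * (4 * c + 2 * c / del) ^+ 2 / (8 * del ^+ 2)) * G + m%:R * del.
Proof.
move=> c0 d0 G0 cphi nphi w0 hw hq xdec xx0 wx0 gG.
(* The two summands give [c / k <= 1/4] and [c / k <= del / 2]: the first controls the variation of
   [w] on a ball, the second that of [phi * w ^+ 2]. *)
set k := 4 * c + 2 * c / del.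
have k4 : 4 * c <= k by rewrite /k lerDl divr_ge0 ?mulr_ge0// ltW.
have kd : 2 * c <= k * del.
  have -> : k * del = 4 * (c * del) + 2 * c by rewrite /k; field; rewrite gt_eqF.
  by have := mulr_gt0 c0 d0; lra.
have k0 : 0 < k by lra.
have ck : c / k <= 4^-1 by rewrite ler_pdivrMr//; lra.
have ckd : c / k <= del / 2 by rewrite ler_pdivrMr//; lra.
pose om i := modulus (w (x i)); have om0 i : 0 < om i by rewrite modulus_gt0.
pose r i := `|x i - x0|; have r0 i : 0 < r i by rewrite normr_gt0 subr_eq0.
pose L i := (om i / k) ^+ 2.
have omk0 i : 0 < om i / k by rewrite divr_gt0.
(* Hoelder continuity and the smallness of [w x0] give [om i <= 2 c sqrt (r i)], and [k >= 4 c]. *)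
have Lr i : L i <= r i / 4.
  have s0 : 0 < Num.sqrt (r i) by rewrite sqrtr_gt0.
  have H : om i <= 2 * c * Num.sqrt (r i).
    have H1 := hw x0 (x i); have H2 := wx0 i.
    have H3 := ler_modulusD (w (x i) - w x0) (w x0); rewrite subrK in H3.
    by rewrite /om; rewrite /r; lra.
  have : om i / k <= Num.sqrt (r i) / 2.
    by rewrite ler_pdivrMr//; nra.
  have -> : r i / 4 = (Num.sqrt (r i) / 2) ^+ 2.
    by rewrite exprMn sqr_sqrtr ?ltW// expr2 -invfM -natrM.
  by rewrite /L ler_pXn2r// ?nnegrE ltW// divr_gt0.
have near i z : `|z - x i| < L i ->
    modulus (w z - w (x i)) <= c * (om i / k) /\
    modulus (phi z * w z ^+ 2 - phi (x i) * w (x i) ^+ 2) <= c * (om i / k).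
  move=> zi; have S : Num.sqrt `|z - x i| <= om i / k.
    by rewrite -[leRHS]gtr0_norm// -[leRHS]sqrtr_sqr ler_wsqrtr// ltW.
  by split; [apply: le_trans (hw _ _) _|apply: le_trans (hq _ _) _];
     rewrite ler_wpM2l// ltW.
pose A := [set i | del <= modulus (phi (x i) * w (x i))]%SET.
have cardA : #|A|%:R * (8 * del ^+ 2 / (81 * k ^+ 2)) <= c ^+ 2.
  apply: (@norm2_ball_card _ phi _ _ _ A x L) => //.
  - exact: ltW.
  - by move=> i _; rewrite sqr_ge0.
  (* A common point [z] would give [r i <= r i / 4 + r i / 8 + r i / 2], since [r j] is at most half
     of [r i]. *)
  - have H (i j : 'I_m) z : (i < j)%N -> `|z - x i| < L i -> `|z - x j| < L j -> False.
      move=> ij zi zj; have := xdec i j ij; have := Lr i; have := Lr j.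
      rewrite -/(r i) -/(r j) => Lj Li rij.
      have T1 := ler_distD z (x i) x0; rewrite [`|x i - z|]distrC -/(r i) in T1.
      have T2 := ler_distD (x j) z x0; rewrite -/(r j) in T2.
      have := r0 i; lra.
    move=> i j z _ _ zi zj; case: (ltngtP i j) => [ij|ji|/val_inj//].
      by case: (H i j z).
    by case: (H j i z).
  - move=> i; rewrite inE modulusM => gi.
    (* On the ball [|phi w^2| >= del * om i / 2] and [|w| <= 3/2 * om i]; dividing gives this lower
       bound for [|phi|]. In [2 * L i * d ^+ 2] the factors [om i] cancel. *)
    exists (2 * del / (9 * om i)); first by rewrite divr_ge0 ?mulr_ge0// ltW.
    split.
      rewrite le_eqVlt; apply/orP; left; apply/eqP; rewrite /L; field.
      by rewrite !gt_eqF.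
    move=> z /near[wz qz]; rewrite ler_pdivrMr ?mulr_gt0//.
    have pz := modulus_ge0 (phi z); have oi := om0 i.
    have W : modulus (w z) <= 3 / 2 * om i.
      have := lerB_modulus (w z) (w (x i)); rewrite -/(om i) => H.
      have : c * (om i / k) <= 4^-1 * om i by rewrite mulrCA mulrC ler_wpM2r// ltW.
      lra.
    have Q : del / 2 * om i <= modulus (phi z * w z ^+ 2).
      have := lerB_modulus (phi (x i) * w (x i) ^+ 2) (phi z * w z ^+ 2).
      rewrite [X in _ <= X]modulusBC modulusM modulusX -/(om i) => H.
      have : c * (om i / k) <= del / 2 * om i by rewrite mulrCA mulrC ler_wpM2r// ltW.
      have : del * om i <= modulus (phi (x i)) * om i ^+ 2.
        by rewrite expr2 mulrA ler_wpM2r// ltW.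
      lra.
    have W2 : modulus (w z) ^+ 2 <= (3 / 2 * om i) ^+ 2.
      by rewrite ler_pXn2r// ?nnegrE ?modulus_ge0// mulr_ge0// ltW.
    rewrite modulusM modulusX in Q.
    have : del / 2 * om i <= modulus (phi z) * (3 / 2 * om i) ^+ 2.
      exact: le_trans Q (ler_wpM2l pz W2).
    have -> : modulus (phi z) * (3 / 2 * om i) ^+ 2 =
      (modulus (phi z) * (9 * om i)) / 4 * om i by field.
    rewrite ler_pM2r//; lra.
have {}cardA : #|A|%:R <= c ^+ 2 * (81 * k ^+ 2 / (8 * del ^+ 2)).
  have e0 : 0 < 8 * del ^+ 2 / (81 * k ^+ 2).
    by rewrite divr_gt0// mulr_gt0// exprn_gt0.
  rewrite -(ler_pM2r e0) (le_trans cardA)// le_eqVlt; apply/orP; left; apply/eqP.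
  by field; rewrite !gt_eqF.
(* A point of [A] costs at most [G], any other point at most [del]. *)
apply: (@le_trans _ _ (\sum_i ((i \in A)%:R * G + del))).
  apply: ler_sum => i _; have gi := gG i.
  rewrite inE; case: (leP del _) => ?; rewrite ?mul1r; first lra.
  by rewrite mul0r add0r ltW.
rewrite big_split /= -mulr_suml sumr_const card_ord [X in _ <= _ + X]mulr_natl lerD2r.
rewrite -natr_sum (_ : (\sum_i (i \in A))%N = #|A|) ?ler_wpM2r//.
by rewrite -sum1_card [RHS]big_mkcond; apply: eq_bigr => i _; case: (i \in A).
Qed.

End Concentration.

(** * Rotation of a complex-valued function *)

Section Direction.
Variable R : realType.
Local Notation C := R[i].
Implicit Types (f : R -> C) (x y : R).

(** [tangent Psi a t] unfolds to the direction of [Zaof Psi a t]. *)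
Definition direction (z : C) : C := z / `|z|.

Lemma directionE z : direction z = z * ((modulus z)^-1)%:C.
Proof.
rewrite /direction normCE; congr (_ * _).
by case: (eqVneq (modulus z) 0) => [->|m0]; rewrite fmorphV.
Qed.

Lemma cvg_direction (T : Type) (F : set_system T) {FF : Filter F} (f : T -> C) (l : C) :
  l != 0 -> f @ F --> l -> (fun t => direction (f t)) @ F --> direction l.
Proof.
move=> l0 fl; have nl : (`|f t| : C) @[t --> F] --> (`|l| : C).
  by apply/cvgC_modulus => e e0; have /cvgC_modulus/(_ _ e0) := fl;
    apply: filterS => t; apply: le_lt_trans; rewrite !normCE -rmorphB modulusR;
    rewrite ler_norml lerB_modulus andbT lerNl opprB modulusBC lerB_modulus.
have nl0 : (`|l| : C) != 0 by rewrite normr_eq0.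
exact: (cvgMC fl (cvgVC nl0 nl)).
Qed.

(* The direction of [f] rotates at the rate [Im (f' / f)]. *)
Lemma is_derive_Re_direction (A : set R) f x (l u : C) : nbhs x A ->
  has_deriv A f x (f x * l) -> f x != 0 ->
  exists2 d, is_derive x (1 : R) (fun y => complex.Re (u * direction (f y))) d &
    `|d| <= modulus u * `|complex.Im l|.
Proof.
move=> Ax df fx0; have m0 : 0 < modulus (f x) by rewrite modulus_gt0.
pose p y := complex.Re (u * f y).
pose S y := complex.Re (1 * f y) ^+ 2 + complex.Re ('i * f y) ^+ 2.
have SE y : S y = modulus (f y) ^+ 2.
  by rewrite sqr_modulus /S; case: (f y) => a b /=; ring.
have NE y : modulus (f y) = Num.sqrt (S y).
  by rewrite SE sqrtr_sqr ger0_norm ?modulus_ge0.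
have dp : is_derive x (1 : R) p (complex.Re (u * (f x * l))).
  exact: has_deriv_is_derive df.
have dS : is_derive x (1 : R) S (2 * modulus (f x) ^+ 2 * complex.Re l).
  have d1 := has_deriv_is_derive 1 Ax df.
  have d2 := has_deriv_is_derive 'i Ax df.
  have -> : S = (fun y => complex.Re (1 * f y)) ^+ 2 +
      (fun y => complex.Re ('i * f y)) ^+ 2 by apply/funext => y; rewrite /S !fctE.
  apply: is_derive_eq.
  rewrite sqr_modulus /GRing.scale /=; case: (f x) (l) => [a b] [l1 l2] /=; ring.
have S0 : 0 < S x by rewrite SE exprn_gt0.
have dN : is_derive x (1 : R) (Num.sqrt \o S) (modulus (f x) * complex.Re l).
  apply: is_derive_eq; first exact: is_derive1_comp (is_derive1_sqrt S0) dS.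
  by rewrite -NE; field; rewrite gt_eqF.
have N0 : (Num.sqrt \o S) x != 0 by rewrite /= -NE gt_eqF.
exists (- complex.Im (u * f x) * complex.Im l / modulus (f x)); last first.
  rewrite !normrM normrN normfV (gtr0_norm m0) ler_pdivrMr//.
  by rewrite mulrAC -modulusM ler_wpM2r// normr_Im.
have -> : (fun y => complex.Re (u * direction (f y))) =
    p * (fun y => ((Num.sqrt \o S) y)^-1).
  apply/funext => y; rewrite mulrfctE /= directionE mulrA /p -NE.
  by case: (u * f y) => a b /=; rewrite mulr0 subr0.
have dV := is_deriveV N0 dN.
apply: is_derive_eq.
rewrite /GRing.scale /= -NE /p.
case: (u) (f x) (modulus (f x)) m0 (l) => [u1 u2] [a b] m m0 [l1 l2] /=.
by field; rewrite gt_eqF.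
Qed.

(** Each displacement is tested against the conjugate of its own direction, and the mean value
    theorem is applied once, to the sum. It yields one intermediate time common to all indices,
    which is where the bound [B] on the sum of the [gam i] can be used. The real part [rho] of the
    rate only stretches [zeta]. *)
Lemma sum_direction_le (m : nat) (zeta : 'I_m -> R -> C) (gam : 'I_m -> R -> C)
    (rho : 'I_m -> R -> R) (T0 B : R) :
  (forall i s, 0 <= s <= T0 -> zeta i s != 0) ->
  (forall i s, 0 <= s <= T0 -> has_deriv `[0, T0] (zeta i) s
     (zeta i s * (gam i s - (rho i s)%:C))) ->
  (forall s, 0 <= s <= T0 -> \sum_i modulus (gam i s) <= B) ->
  forall t, 0 <= t <= T0 ->
  \sum_i modulus (direction (zeta i t) - direction (zeta i 0)) <= t * B.
Proof.
move=> z0 dz sB t /andP[t0 tT].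
pose D i := direction (zeta i t) - direction (zeta i 0).
pose u i := ((direction (D i))^*)%C.
have dirD z : complex.Re (((direction z)^*)%C * z) = modulus z.
  rewrite directionE; case: (eqVneq z 0) => [->|z1].
    by rewrite mulr0 modulus0.
  have m0 : modulus z != 0 by rewrite modulus_eq0.
  have : complex.Re (((z * ((modulus z)^-1)%:C)^*)%C * z) = (modulus z)^-1 * modulus z ^+ 2.
    by rewrite sqr_modulus; case: (z) (modulus z) => a b r /=; ring.
  by move->; field.
have u1 i : modulus (u i) <= 1.
  rewrite /u modulus_conj directionE modulusM modulusR.
  rewrite ger0_norm ?invr_ge0 ?modulus_ge0//.
  by case: (eqVneq (modulus (D i)) 0) => [->|m0]; rewrite ?mul0r// mulfV.
pose P i y := complex.Re (u i * direction (zeta i y)).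
pose Q := \sum_(i < m) P i.
have QE : Q t - Q 0 = \sum_i modulus (D i).
  rewrite /Q !fct_sumE -sumrB; apply: eq_bigr => i _.
  rewrite -dirD /P /u /D; case: (_^*)%C => a b.
  by case: (direction _) (direction _) => [a1 b1] [a2 b2] /=; ring.
(* With the implication inside the existential, choice gives a derivative defined at every [s]; the
   value 0 outside the open interval is arbitrary. *)
have dP i s : exists d, 0 < s < T0 -> is_derive s (1 : R) (P i) d /\
    `|d| <= modulus (gam i s).
  have [sT|] := boolP (0 < s < T0); last by exists 0.
  have /andP[s0 s1] := sT.
  have sT' : 0 <= s <= T0 by rewrite !ltW.
  have As : nbhs s `[0, T0]%classic.
    apply: filterS (near_in_itvoo _); first exact: subset_itv_oo_cc.
    by rewrite in_itv /= s0 s1.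
  have [d H1 H2] := is_derive_Re_direction (u i) As (dz i s sT') (z0 i s sT').
  exists d => _; split=> //; apply: (le_trans H2).
  rewrite -[leRHS]mul1r ler_pM ?modulus_ge0//.
  rewrite (_ : complex.Im _ = complex.Im (gam i s)) ?normr_Im//.
  by case: (gam i s) => a b /=; rewrite subr0.
pose d i s := projT1 (cid (dP i s)).
have dPd i s : 0 < s < T0 -> is_derive s (1 : R) (P i) (d i s) /\
    `|d i s| <= modulus (gam i s) by exact: (projT2 (cid (dP i s))).
rewrite -/(\sum_i modulus (D i)) -QE.
have dQ s : s \in `]0, t[%R -> is_derive s (1 : R) Q (\sum_(i < m) d i s).
  rewrite in_itv /= => /andP[s0 st]; apply: is_derive_sum => i.
  by have [] := dPd i s; rewrite // s0 (lt_le_trans st tT).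
have cQ : {within `[0, t], continuous Q}.
  apply/subspace_continuousP => s; rewrite /= in_itv /= => /andP[s0 st].
  have sT : 0 <= s <= T0 by rewrite s0 (le_trans st tT).
  have cP i : P i @ within `[0, t] (nbhs s) --> P i s.
    have cz : zeta i @ within `[0, t] (nbhs s) --> zeta i s.
      apply/cvgC_modulus => e e0; have [r r0 H] := has_deriv_cont (dz i s sT) e0.
      apply/nbhs_ballP; exists r => // y; rewrite /ball /= => ys.
      rewrite in_itv /= => /andP[y0 yt]; apply: H; last by rewrite distrC.
      by rewrite /= in_itv /= y0 (le_trans yt tT).
    have /cvgC_modulus H : direction (zeta i y) @[y --> within `[0, t] (nbhs s)]
        --> direction (zeta i s) by exact: (cvg_direction (z0 i s sT) cz).
    apply/cvgrPdist_le => e e0; have := H e e0; apply: filterS => y Hy.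
    apply: le_trans (ltW Hy); rewrite distrC -[leRHS]mul1r.
    apply: le_trans (ler_wpM2r (modulus_ge0 _) (u1 i)); rewrite -modulusM mulrBr.
    apply: le_trans (normr_Re _); rewrite /P.
    by case: (_ * _) (_ * _) => [a1 b1] [a2 b2].
  apply: (big_ind (fun f : R -> R => f @ within `[0, t] (nbhs s) --> f s)).
  - exact: cvg_cst.
  - by move=> f g cf cg; exact: cvgD.
  - by move=> i _; exact: cP.
rewrite le_eqVlt in t0; case/orP: t0 => [/eqP <-|t0].
  by rewrite subrr mul0r.
have [c + ->] := MVT t0 dQ cQ; rewrite in_itv /= => /andP[c0 ct].
have cT : c < T0 := lt_le_trans ct tT.
rewrite subr0 mulrC ler_wpM2l ?(ltW t0)//.
apply: (@le_trans _ _ (\sum_i modulus (gam i c))); last by rewrite sB// !ltW.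
by apply: ler_sum => i _; have [|_] := dPd i c; rewrite ?c0//; apply: le_trans (ler_norm _).
Qed.

End Direction.

(** * Chain rules and boundary traces *)

Section Chain.
Variable R : realType.
Local Notation C := R[i].
Implicit Types (A : set R) (f g : R -> C) (x y : R) (l m : C).

Lemma has_deriv_lipschitz A f x l : has_deriv A f x l ->
  exists2 d, 0 < d & forall y, A y -> `|y - x| < d ->
    modulus (f y - f x) <= (modulus l + 1) * `|y - x|.
Proof.
move=> /has_derivP/(_ _ ltr01)[d d0 H]; exists d => // y Ay yd.
rewrite -(subrK (l * (y - x)%:C) (f y - f x)).
apply: le_trans (ler_modulusD _ _) _.
by rewrite modulusM modulusR addrC mulrDl lerD2l H.
Qed.

Lemma has_deriv_comp A f (X : R -> R) x l m :
  has_deriv setT f (X x) l -> has_deriv A (fun y => (X y)%:C) x m ->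
  has_deriv A (fun y => f (X y)) x (l * m).
Proof.
move=> fl Xm; apply/has_derivP => e e0.
have [d2 d20 H2] := has_deriv_lipschitz Xm.
have m0 := modulus_ge0 m; have l0 := modulus_ge0 l.
have [|d1 d10 H1] := (has_derivP _ _ _ _).1 fl (e / 2 / (modulus m + 1)).
  by rewrite !divr_gt0//; lra.
have [|d3 d30 H3] := (has_derivP _ _ _ _).1 Xm (e / 2 / (modulus l + 1)).
  by rewrite !divr_gt0//; lra.
have [d4 d40 H4] := has_deriv_cont Xm d10.
exists (Num.min d2 (Num.min d3 d4)); first by rewrite !lt_min d20 d30 d40.
move=> y Ay; rewrite !lt_min => /and3P[y2 y3 y4].
have {}H4 := H4 y Ay y4; rewrite -rmorphB modulusR in H4.
have {}H2 := H2 y Ay y2; rewrite -rmorphB modulusR in H2.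
have {}H1 := H1 (X y) I H4.
have {}H3 := H3 y Ay y3.
have -> : f (X y) - f (X x) - l * m * (y - x)%:C =
  (f (X y) - f (X x) - l * (X y - X x)%:C) +
  l * ((X y)%:C - (X x)%:C - m * (y - x)%:C) by rewrite rmorphB; ring.
apply: le_trans (ler_modulusD _ _) _; rewrite modulusM.
have -> : e * `|y - x| = e / 2 * `|y - x| + e / 2 * `|y - x| by field.
apply: lerD.
  apply: (le_trans H1); rewrite -mulrA ler_wpM2l//; first lra.
  by rewrite ler_pdivrMl//; lra.
apply: le_trans (ler_wpM2l l0 H3) _; rewrite mulrA ler_wpM2r//.
by rewrite mulrCA ger_pMr ?divr_gt0// ler_pdivrMr; lra.
Qed.

Lemma has_deriv_chain (T0 : R) (G Gx : R -> R -> C) (X : R -> R) s l m :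
  (forall a s', 0 <= s' <= T0 -> has_deriv setT (G ^~ s') a (Gx a s')) ->
  (forall e, 0 < e -> exists2 d, 0 < d & forall a s', 0 <= s' <= T0 ->
     `|a - X s| < d -> `|s' - s| < d -> modulus (Gx a s' - Gx (X s) s) < e) ->
  has_deriv `[0, T0] (G (X s)) s l ->
  has_deriv `[0, T0] (fun s' => (X s')%:C) s m ->
  has_deriv `[0, T0] (fun s' => G (X s') s') s (Gx (X s) s * m + l).
Proof.
move=> dG cGx Gl Xm; apply/has_derivP => e e0.
set k := Gx (X s) s.
have [d2 d20 H2] := has_deriv_lipschitz Xm.
have m0 := modulus_ge0 m; have k0 := modulus_ge0 k.
have [|d1 d10 H1] := cGx (e / 3 / (modulus m + 1)).
  by rewrite !divr_gt0//; lra.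
have [|d3 d30 H3] := (has_derivP _ _ _ _).1 Xm (e / 3 / (modulus k + 1)).
  by rewrite !divr_gt0//; lra.
have [|d5 d50 H5] := (has_derivP _ _ _ _).1 Gl (e / 3).
  by rewrite divr_gt0.
have [d4 d40 H4] := has_deriv_cont Xm d10.
exists (Num.min d1 (Num.min d2 (Num.min d3 (Num.min d4 d5)))).
  by rewrite !lt_min d10 d20 d30 d40 d50.
move=> y Ay; rewrite !lt_min => /and5P[y1 y2 y3 y4 y5].
have {}H4 := H4 y Ay y4; rewrite -rmorphB modulusR in H4.
have {}H2 := H2 y Ay y2; rewrite -rmorphB modulusR in H2.
have {}H3 := H3 y Ay y3; have {}H5 := H5 y Ay y5.
have yT : 0 <= y <= T0 by move: Ay; rewrite /= in_itv.
have {}H1 : modulus (G (X y) y - G (X s) y - k * (X y - X s)%:C) <=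
    e / 3 / (modulus m + 1) * `|X y - X s|.
  apply: (@mean_value_le R (G ^~ y) (Gx ^~ y)) => x xI; first exact: dG.
  apply/ltW/H1 => //; apply: le_lt_trans H4.
  exact: ler_norm_between.
have -> : G (X y) y - G (X s) s - (k * m + l) * (y - s)%:C =
  (G (X y) y - G (X s) y - k * (X y - X s)%:C) +
  k * ((X y)%:C - (X s)%:C - m * (y - s)%:C) +
  (G (X s) y - G (X s) s - l * (y - s)%:C) by rewrite (rmorphB _ (X y)); ring.
apply: le_trans (ler_modulusD _ _) _.
have -> : e * `|y - s| = e / 3 * `|y - s| + e / 3 * `|y - s| + e / 3 * `|y - s|.
  by field.
apply: lerD => //; apply: le_trans (ler_modulusD _ _) _; rewrite modulusM.
apply: lerD.
  apply: (le_trans H1); rewrite -mulrA ler_wpM2l//; first lra.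
  by rewrite ler_pdivrMl//; lra.
apply: le_trans (ler_wpM2l k0 H3) _; rewrite mulrA ler_wpM2r//.
by rewrite mulrCA ger_pMr ?divr_gt0// ler_pdivrMr; lra.
Qed.

Lemma has_deriv_real A (X : R -> R) x l : ProperFilter (within A x^') ->
  has_deriv A (fun y => (X y)%:C) x l -> l = (complex.Re l)%:C.
Proof.
move=> FF /cvgC_modulus H; apply/eqP; rewrite eq_complex /= eqxx /=.
(* Difference quotients of a real function are real, so they stay at distance at least [|Im l|] from
   [l]; that number serves as the tolerance. *)
apply/negPn/negP; rewrite -normr_gt0 => l0.
have [y] := filter_ex (H _ l0).
rewrite /diff_quot -rmorphB -fmorphV -rmorphM /=.
case: l {l0 H} => a b; move=> /(le_lt_trans (normr_Im _)) /=.
by rewrite sub0r normrN ltxx.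
Qed.

Lemma cont_on_clhpP (T0 : R) (G : C -> R -> C) : cont_on (@clhp R) T0 G ->
  forall z t, clhp z -> 0 <= t <= T0 -> forall e, 0 < e ->
  exists2 d, 0 < d & forall z' t', clhp z' -> 0 <= t' <= T0 ->
    modulus (z' - z) < d -> `|t' - t| < d -> modulus (G z' t' - G z t) < e.
Proof.
move=> /subspace_continuousP cG z t zc tT e e0.
have /cvgC_modulus/(_ _ e0) := cG (z, t) (conj zc tT).
move=> -[[U V] /= [/nbhs_ballP[r1 r10 HU] /nbhs_ballP[r2 r20 HV]] H].
move: r10 => /=; rewrite ltcE => /andP[/eqP i0 r10].
exists (Num.min (complex.Re r1) r2); first by rewrite lt_min r10 r20.
move=> z' t' zc' tT'; rewrite !lt_min => /andP[z1 _] /andP[_ t2].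
apply: (H (z', t')) => //; split=> /=; last by apply: HV; rewrite /ball /= distrC.
apply: HU; rewrite /ball /= normCE modulusBC.
by case: (r1) i0 z1 => a b /= ->; rewrite -ltcR.
Qed.

End Chain.

Section Trace.
Variable R : realType.
Local Notation C := R[i].
Implicit Types (g : C -> C) (z : C).

(** The directions [v = 1] and [v = 'i] give both partial derivatives from the complex one. The line
    is a function [X] with its equation so that [hline] and [vline] fit. *)
Lemma derivable_has_deriv_line g z (v : C) (X : R -> C) (x : R) :
  (forall y, X y = z + (y - x)%:C * v) -> derivable g z 1 ->
  has_deriv setT (fun y => g (X y)) x (v * 'D_1 g z).
Proof.
move=> XE dg.
have /cvgC_modulus H : h^-1 *: ((g \o shift z) (h *: 1) - g z) @[h --> 0^'] --> 'D_1 g z.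
  exact: dg.
apply/has_derivP => e e0; have v0 := modulus_ge0 v.
have [|r /= r0 Hr] := (nbhs_ballP _ _).1 (H (e / (modulus v + 1)) _).
  by rewrite divr_gt0//; lra.
move: r0 Hr; rewrite ltcE => /andP[/eqP]; case: r => r r' /= -> r0 Hr.
exists (r / (modulus v + 1)); first by rewrite divr_gt0//; lra.
move=> y _ yx; have [->|yx0] := eqVneq y x.
  by rewrite !subrr mulr0 subrr modulus0 normr0 mulr0.
have [v00|vn0] := eqVneq v 0.
  rewrite !XE v00 !mulr0 !addr0 subrr mul0r mul0r subrr modulus0.
  by rewrite mulr_ge0// ltW.
pose k := (y - x)%:C * v.
have kM : modulus k = `|y - x| * modulus v by rewrite modulusM modulusR.
have k0 : k != 0.
  by rewrite -modulus_gt0 kM mulr_gt0 ?modulus_gt0// normr_gt0 subr_eq0.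
have kr : ball (0 : C) r%:C k.
  rewrite /ball /= sub0r normrN normCE ltcR kM.
  move: yx; rewrite ltr_pdivlMr; last by lra.
  by have := normr_ge0 (y - x); nra.
have := Hr k kr k0; rewrite /GRing.scale /= mulr1 => B.
rewrite !XE subrr mul0r addr0.
have -> : g (z + (y - x)%:C * v) - g z - v * 'D_1 g z * (y - x)%:C =
    k * (k^-1 * (g (k + z) - g z) - 'D_1 g z).
  by rewrite mulrBr mulrA divff// mul1r [z + _]addrC /k; congr (_ - _); ring.
rewrite modulusM kM mulrC mulrA [leLHS]mulrAC ler_wpM2r//.
apply: le_trans (ler_wpM2r v0 (ltW B)) _.
rewrite -mulrA ger_pMr// mulrC ler_pdivrMr; lra.
Qed.

(** By the Cauchy-Riemann equation [dy g = 'i * dx g], the two halves of [dz] coincide. *)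
Lemma dz_holomorphic g z : derivable g z 1 -> dz g z = dx g z.
Proof.
move=> dg.
have Hx : dx g z = 'D_1 g z.
  rewrite /dx (@deriv_setT _ _ _ ('D_1 g z))// -[X in has_deriv _ _ _ X]mul1r.
  apply: derivable_has_deriv_line dg => y; case: (z) => a b /=.
  by apply/eqP; rewrite eq_complex /=; apply/andP; split; apply/eqP; ring.
have Hy : dy g z = 'i * 'D_1 g z.
  apply: deriv_setT; apply: derivable_has_deriv_line dg => y; case: (z) => a b /=.
  by apply/eqP; rewrite eq_complex /=; apply/andP; split; apply/eqP; ring.
rewrite /dz Hx Hy mulrA -expr2 sqr_i mulN1r opprK -mulr2n.
by rewrite -[X in X / _]mulr_natr mulfK// pnatr_eq0.
Qed.

Lemma proper_within_lhp (a : R) : ProperFilter (within (@lhp R) (nbhs (a%:C : C))).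
Proof.
split; last exact: within_filter.
move=> /nbhs_ballP[r /= r0 H]; move: r0 H; rewrite ltcE => /andP[/eqP].
case: r => r r' /= -> r0 H.
apply: (H (a +i* (- (r / 2)))).
  rewrite /ball /= normCE ltcR.
  have -> : a%:C - (a +i* (- (r / 2))) = (r / 2)%:C * 'i.
    by apply/eqP; rewrite eq_complex /=; apply/andP; split; apply/eqP; ring.
  rewrite modulusM modulusR gtr0_norm ?divr_gt0//.
  by rewrite /modulus /= expr0n expr1n add0r sqrtr1 mulr1; lra.
by rewrite /lhp /= oppr_lt0 divr_gt0.
Qed.

Lemma bext_lim g (a : R) (l : C) :
  g w @[w --> within (@lhp R) (nbhs (a%:C : C))] --> l -> bext g a%:C = l.
Proof.
move=> H; rewrite /bext /= ltxx; have ? := proper_within_lhp a.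
by apply: cvg_lim => //; exact: norm_hausdorff.
Qed.

End Trace.

(** * Smooth functions on the boundary line *)

Section SmoothFunctions.
Variable R : realType.
Local Notation C := R[i].

Lemma has_deriv_continuous (f f' : R -> C) :
  (forall x, has_deriv setT f x (f' x)) -> continuous f.
Proof.
move=> df x; apply/cvgC_modulus => e e0.
have [d d0 H] := has_deriv_cont (df x) e0.
by apply/nbhs_ballP; exists d => // y; rewrite /ball /= distrC; exact: H.
Qed.

Definition C1 (f : R -> C) :=
  exists2 f', (forall x, has_deriv setT f x (f' x)) & continuous f'.

Lemma C1_continuous f : C1 f -> continuous f.
Proof. by move=> [f' df _]; exact: has_deriv_continuous df. Qed.

Lemma C1M f g : C1 f -> C1 g -> C1 (fun x => f x * g x).
Proof.
move=> [f' df cf] [g' dg cg]; exists (fun x => f' x * g x + f x * g' x).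
  by move=> x; exact: has_derivM.
have cf0 := has_deriv_continuous df; have cg0 := has_deriv_continuous dg.
by move=> x; exact: (cvgDC (cvgMC (cf x) (cg0 x)) (cvgMC (cf0 x) (cg x))).
Qed.

Lemma C1V f : (forall x, f x != 0) -> C1 f -> C1 (fun x => (f x)^-1).
Proof.
move=> f0 [f' df cf]; exists (fun x => - f' x / f x ^+ 2).
  by move=> x; exact: has_derivV.
have cf0 := has_deriv_continuous df; move=> x.
have f20 : f x ^+ 2 != 0 by rewrite expf_neq0.
have cf1 : - f' y @[y --> x] --> - f' x by exact: (cvgN (cf x)).
have cf2 : f y ^+ 2 @[y --> x] --> f x ^+ 2 by exact: (cvgMC (cf0 x) (cf0 x)).
exact: (cvgMC cf1 (cvgVC f20 cf2)).
Qed.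

(** The uniform bounds concern [da], a limit of difference quotients; it is identified here with the
    continuous derivative that [norm2_holder] requires. *)
Lemma C1_holder f (c : R) : C1 f -> 0 < c ->
  (norm2 (Defs.deriv setT f) <= c%:E)%E ->
  forall x y, modulus (f y - f x) <= c * Num.sqrt `|y - x|.
Proof.
move=> [f' df cf] c0 H; apply: (norm2_holder df cf c0).
by have <- : Defs.deriv setT f = f' by apply/funext => x; exact: (deriv_setT (df x)).
Qed.

Lemma cont_on_lineP (T0 : R) (G : R -> R -> C) : cont_on setT T0 G <->
  forall a t, 0 <= t <= T0 -> forall e, 0 < e ->
  exists2 d, 0 < d & forall a' t', 0 <= t' <= T0 ->
    `|a' - a| < d -> `|t' - t| < d -> modulus (G a' t' - G a t) < e.
Proof.
split.
  move=> /subspace_continuousP cG a t tT e e0.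
  have /cvgC_modulus/(_ _ e0) := cG (a, t) (conj I tT).
  move=> [[U V] /= [/nbhs_ballP[r1 /= r10 HU] /nbhs_ballP[r2 /= r20 HV]] H].
  exists (Num.min r1 r2); first by rewrite lt_min r10 r20.
  move=> a' t' tT'; rewrite !lt_min => /andP[a1 _] /andP[_ t2].
  apply: (H (a', t')) => //.
  by split=> /=; [apply: HU|apply: HV]; rewrite /ball /= distrC.
move=> H; apply/subspace_continuousP => -[a t] [_ /= tT].
apply/cvgC_modulus => e e0; have [d d0 Hd] := H a t tT e e0.
exists (ball a d, ball t d) => /=; first by split; exact: nbhsx_ballx.
by move=> [a' t'] [/= a1 t1] [_ tT']; apply: Hd => //; rewrite distrC.
Qed.

(** The derivatives of order zero in [y'] restrict to the real axis. *)
Lemma smooth_clhp_line (T0 : R) (G : C -> R -> C) :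
  smooth_clhp T0 G -> smooth_line T0 (fun a t => G a%:C t).
Proof.
move=> [D [D0 HD]]; exists (fun i k a t => D i 0%N k a%:C t).
have bd (a : R) : clhp (a%:C : C) by rewrite /clhp /=.
split=> [a t tT|i k]; first exact: D0.
have [cD dD] := HD i 0%N k; split=> [|a t tT].
  apply/cont_on_lineP => a t tT e e0.
  have [d d0 Hd] := cont_on_clhpP cD (bd a) tT e0; exists d => // a' t' tT' aa tt.
  by apply: Hd => //; rewrite -rmorphB modulusR.
have [H1 _ H2] := dD a%:C t (bd a) tT.
split; [exact: H1|exact: H2].
Qed.

Lemma smooth_line_conj (T0 : R) (G : R -> R -> C) :
  smooth_line T0 G -> smooth_line T0 (fun a t => (G a t)^*)%C.
Proof.
move=> [D [D0 HD]]; exists (fun i k a t => (D i k a t)^*)%C.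
split=> [a t tT|i k]; first by rewrite D0.
have [cD dD] := HD i k; split=> [|a t tT].
  apply/cont_on_lineP => a t tT e e0.
  have [d d0 Hd] := (cont_on_lineP _ _).1 cD a t tT e e0.
  by exists d => // a' t' tT' aa tt; rewrite -rmorphB modulus_conj Hd.
by have [H1 H2] := dD a t tT; split; exact: has_deriv_conj.
Qed.

(** The family [D] agrees with [G] only for times in [[0, T0]]; its first derivatives are
    transferred to [G] and [da G] there. *)
Lemma smooth_line_da (T0 : R) (G : R -> R -> C) : smooth_line T0 G ->
  exists D : nat -> nat -> R -> R -> C,
  [/\ forall a t, 0 <= t <= T0 -> D 1%N 0%N a t = da G a t,
      forall a t, 0 <= t <= T0 -> has_deriv setT (G ^~ t) a (da G a t),
      forall a t, 0 <= t <= T0 -> has_deriv `[0, T0] (G a) t (D 0%N 1%N a t),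
      forall i k a t, 0 <= t <= T0 -> has_deriv setT (D i k ^~ t) a (D i.+1 k a t) /\
        has_deriv `[0, T0] (D i k a) t (D i k.+1 a t) &
      forall i k, cont_on setT T0 (D i k)].
Proof.
move=> [D [D0 HD]]; exists D.
have HD' i k a t : 0 <= t <= T0 -> has_deriv setT (D i k ^~ t) a (D i.+1 k a t) /\
        has_deriv `[0, T0] (D i k a) t (D i k.+1 a t).
  by move=> tT; have [_] := HD i k; apply.
have E t : 0 <= t <= T0 -> G ^~ t = D 0%N 0%N ^~ t.
  by move=> tT; apply/funext => b; rewrite D0.
have D1 a t : 0 <= t <= T0 -> D 1%N 0%N a t = da G a t.
  by move=> tT; rewrite /da E// (deriv_setT (HD' _ _ _ _ tT).1).
split=> // [a t tT|a t tT|i k]; last by have [] := HD i k.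
  by rewrite -D1// E//; exact: (HD' _ _ _ _ tT).1.
have [_ H] := HD' 0%N 0%N a t tT.
by apply: has_deriv_eq_on H => // s /=; rewrite in_itv /=; exact: D0.
Qed.

Lemma smooth_line_C1 (T0 : R) (G : R -> R -> C) : smooth_line T0 G ->
  forall t, 0 <= t <= T0 -> C1 (da G ^~ t).
Proof.
move=> /smooth_line_da[D [D1 _ _ HD _]] t tT.
have -> : da G ^~ t = D 1%N 0%N ^~ t by apply/funext => a; rewrite D1.
exists (D 2%N 0%N ^~ t) => [x|]; first exact: (HD _ _ _ _ tT).1.
apply: (has_deriv_continuous (f' := D 3%N 0%N ^~ t)) => x.
exact: (HD _ _ _ _ tT).1.
Qed.

End SmoothFunctions.

(** * The smooth approximations *)

Section Approximation.
Variables (R : realType) (K : wu_constants R) (e c T0 : R).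
Local Notation C := R[i].
Variables (F0 Psi0 : C -> C) (eps : R) (F Psi : C -> R -> C) (P : C -> R -> R).
Variables (h hinv : R -> R -> R).
Hypothesis T00 : 0 < T0.
Hypothesis SA : smooth_approx T0 F0 Psi0 eps F Psi P h hinv.
Hypothesis AB : forall t : R, 0 <= t <= T0 -> approx_bounds K e c T0 F Psi h t.

Let c1 := cst1 K e.
Let c2 := cst2 K e.
Let c10 : 0 < c1. Proof. exact: cst1_gt0. Qed.
Let c20 : 0 < c2. Proof. exact: cst2_gt0. Qed.

Let Zsmooth : smooth_line T0 (Zof Psi) := smooth_clhp_line (sa_Psi SA).
Let Ztsmooth : smooth_line T0 (Ztof F) :=
  smooth_line_conj (smooth_clhp_line (sa_F SA)).
Let hsmooth : smooth_line T0 (cplx h) := sa_h SA.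

Let C0 := CE K e + 1.

(** A bound on a norm only gives [0 <= CE K e]; adding 1 makes it a strictly positive Hoelder
    constant. *)
Lemma CE1_gt0 : 0 < CE K e + 1.
Proof.
have T0I : 0 <= T0 <= T0 by rewrite lexx ltW.
have := ab_Zta (AB T0I); move=> /(le_trans (Lnorm_ge0 _ _ _)).
by rewrite lee_fin => ?; lra.
Qed.

Lemma da_h_neq0 a t : 0 <= t <= T0 -> da (cplx h) a t != 0.
Proof.
by move=> tT; rewrite -modulus_gt0; have [H _] := ab_ha (AB tT) a; apply: lt_le_trans H.
Qed.

Lemma has_deriv_zof a t : 0 <= t <= T0 ->
  has_deriv setT (zof Psi h ^~ t) a (Zaof Psi (h a t) t * da (cplx h) a t).
Proof.
move=> tT; have [D [_ DZ _ _ _]] := smooth_line_da Zsmooth.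
have [H [_ Hh _ _ _]] := smooth_line_da hsmooth.
exact: (has_deriv_comp (DZ (h a t) t tT) (Hh a t tT)).
Qed.

Lemma has_deriv_Ztof_comp a t : 0 <= t <= T0 ->
  has_deriv setT (fun b => Ztof F (h b t) t) a (Ztaof F (h a t) t * da (cplx h) a t).
Proof.
move=> tT; have [D [_ DZ _ _ _]] := smooth_line_da Ztsmooth.
have [H [_ Hh _ _ _]] := smooth_line_da hsmooth.
exact: (has_deriv_comp (DZ (h a t) t tT) (Hh a t tT)).
Qed.

(* The mixed derivatives of [Psi] commute, so differentiating [z_t] in space also
   gives the time derivative of [z_alpha]. *)
Lemma has_deriv_Zaof_flow : exists rho : R -> R -> R, forall a s, 0 <= s <= T0 ->
  has_deriv `[0, T0] (fun r => Zaof Psi (h a r) r) s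
    (Zaof Psi (h a s) s *
       (Ztaof F (h a s) s * (Zaof Psi (h a s) s)^-1 - (rho a s)%:C)).
Proof.
have [D [D1 DZ DZt HD cD]] := smooth_line_da Zsmooth.
have [H [H1 Hh Hht HH _]] := smooth_line_da hsmooth.
have {}D1 a t : 0 <= t <= T0 -> D 1%N 0%N a t = Zaof Psi a t by exact: D1.
have TI s : `[0, T0]%classic s -> 0 <= s <= T0 by rewrite /= in_itv.
have cD' i k a s : 0 <= s <= T0 -> forall d, 0 < d -> exists2 d', 0 < d' &
    forall a' s', 0 <= s' <= T0 -> `|a' - h a s| < d' -> `|s' - s| < d' ->
    modulus (D i k a' s' - D i k (h a s) s) < d.
  by move=> sT; exact: (cont_on_lineP _ _).1 (cD i k) (h a s) s sT.
(* [Z_t] composed with the flow is the time derivative of [Z(h(b,s),s)], expanded by the chain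
   rule. *)
have zt b s : 0 <= s <= T0 ->
    Ztof F (h b s) s = Zaof Psi (h b s) s * H 0%N 1%N b s + D 0%N 1%N (h b s) s.
  move=> sT; rewrite -(sa_zt SA) // /dt -D1 //; apply: deriv_itv => //.
  have dZ a s' : 0 <= s' <= T0 -> has_deriv setT (Zof Psi ^~ s') a (D 1%N 0%N a s').
    by move=> sT'; rewrite D1//; exact: DZ.
  exact: (has_deriv_chain dZ (cD' 1%N 0%N b s sT) (DZt (h b s) s sT) (Hht b s sT)).
have Hreal b s : 0 <= s <= T0 -> H 0%N 1%N b s = (complex.Re (H 0%N 1%N b s))%:C.
  move=> sT; apply: (has_deriv_real (proper_dnbhs_itv T00 sT)).
  exact: (Hht b s sT).
have h1real b s : 0 <= s <= T0 -> da (cplx h) b s = (complex.Re (da (cplx h) b s))%:C.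
  move=> sT; apply: (has_deriv_real (proper_dnbhs_setT b)).
  exact: (Hh b s sT).
have h11real b s : 0 <= s <= T0 -> H 1%N 1%N b s = (complex.Re (H 1%N 1%N b s))%:C.
  move=> sT; apply: (has_deriv_real (X := fun b => complex.Re (H 0%N 1%N b s))
    (proper_dnbhs_setT b)).
  have -> : (fun y => (complex.Re (H 0%N 1%N y s))%:C) = H 0%N 1%N ^~ s.
    by apply/funext => y; rewrite -Hreal.
  exact: (HH 0%N 1%N b s sT).1.
(* This is [h_{t alpha} / h_alpha], the stretching rate of the flow; it is real because [h] is. *)
exists (fun a s => complex.Re (H 1%N 1%N a s) / complex.Re (da (cplx h) a s)).
move=> a s sT; set x := h a s.
have ha0 := da_h_neq0 a sT; have Za0 : Zaof Psi x s != 0 by exact: (sa_Za SA).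
(* The identity [zt] is differentiated in space; [D 1 1] appears as the spatial derivative of
   [D 0 1]. *)
have E : Ztaof F x s * da (cplx h) a s =
   (D 2%N 0%N x s * da (cplx h) a s) * H 0%N 1%N a s + D 1%N 0%N x s * H 1%N 1%N a s +
   D 1%N 1%N x s * da (cplx h) a s.
  rewrite -(deriv_setT (@has_deriv_Ztof_comp a s sT)); apply: deriv_setT.
  have -> : (fun b => Ztof F (h b s) s) = (fun b => D 1%N 0%N (h b s) s * H 0%N 1%N b s +
      D 0%N 1%N (h b s) s) by apply/funext => b; rewrite D1// zt.
  apply: has_derivD; last exact: (has_deriv_comp (HD 0%N 1%N x s sT).1 (Hh a s sT)).
  apply: has_derivM; last exact: (HH 0%N 1%N a s sT).1.
  exact: (has_deriv_comp (HD 1%N 0%N x s sT).1 (Hh a s sT)).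
(* Dividing [E] by [h_alpha] leaves the derivative of [Z_{,alpha'}] along the flow, in chain-rule
   form. *)
have -> : Zaof Psi x s * (Ztaof F x s * (Zaof Psi x s)^-1 -
    (complex.Re (H 1%N 1%N a s) / complex.Re (da (cplx h) a s))%:C) =
    D 2%N 0%N x s * H 0%N 1%N a s + D 1%N 1%N x s.
  have -> : (complex.Re (H 1%N 1%N a s) / complex.Re (da (cplx h) a s))%:C =
      H 1%N 1%N a s / da (cplx h) a s.
    have := h11real a s sT; have := h1real a s sT.
    move: (complex.Re _) (complex.Re _) => r1 r2 -> ->.
    by rewrite -fmorphV -rmorphM.
  rewrite mulrBr mulrCA divff// mulr1.
  apply: (mulIf ha0); rewrite mulrBl E D1//.
  by field.
apply: (@has_deriv_eq_on _ _ (fun r => D 1%N 0%N (h a r) r)).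
- by move=> r /TI rT; rewrite D1.
- by rewrite /= in_itv.
have dD b s' : 0 <= s' <= T0 -> has_deriv setT (D 1%N 0%N ^~ s') b (D 2%N 0%N b s').
  by move=> sT'; exact: (HD 1%N 0%N b s' sT').1.
exact: (has_deriv_chain (X := h a) dD (cD' 2%N 0%N a s sT) (HD 1%N 0%N x s sT).2 (Hht a s sT)).
Qed.

Lemma flow_biLipschitz a b t : 0 <= t <= T0 ->
  c1 * `|a - b| <= `|h a t - h b t| /\ `|h a t - h b t| <= c2 * `|a - b|.
Proof.
move=> tT; wlog ab : a b / b < a => [H|].
  have [ab|ba|->] := ltgtP b a; first exact: H.
    by rewrite (distrC a) (distrC (h a t)); exact: H.
  by rewrite !subrr !normr0 !mulr0.
have [H [_ Hh _ _ _]] := smooth_line_da hsmooth.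
have dh x : is_derive x (1 : R) (h ^~ t) (complex.Re (da (cplx h) x t)).
  rewrite -[da _ _ _]mul1r.
  have -> : h ^~ t = fun y => complex.Re (1 * cplx h y t).
    by apply/funext => y; rewrite mul1r.
  exact: has_deriv_is_derive filterT (Hh x t tT).
have ch : {within `[b, a], continuous (h ^~ t)}.
  by apply: derivable_within_continuous => x _; exact: ex_derive.
have [x _ ->] := MVT ab (fun x _ => dh x) ch.
have -> : `|complex.Re (da (cplx h) x t) * (a - b)| =
    modulus (da (cplx h) x t) * `|a - b|.
  rewrite normrM -modulusR -(has_deriv_real (proper_dnbhs_setT x) (Hh x t tT)) //.
have [H1 H2] := ab_ha (AB tT) x.
by split; apply: ler_wpM2r.
Qed.

Let da_zof a t : 0 <= t <= T0 ->
  da (zof Psi h) a t = Zaof Psi (h a t) t * da (cplx h) a t.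
Proof. by move=> tT; exact: deriv_setT (has_deriv_zof tT). Qed.

Let T0I : 0 <= (0 : R) <= T0. Proof. by rewrite lexx ltW. Qed.

Let da_zof0 a : da (zof Psi h) a 0 = Zaof Psi a 0.
Proof.
rewrite da_zof// (sa_flow0 SA).
have -> : da (cplx h) a 0 = 1; last by rewrite mulr1.
apply: deriv_setT.
have -> : cplx h ^~ 0 = fun b : R => b%:C.
  by apply/funext => b; rewrite /cplx (sa_flow0 SA).
apply/has_derivP => d d0; exists 1 => // y _ _.
by rewrite mul1r rmorphB subrr modulus0 mulr_ge0// ltW.
Qed.

(** Since [z_alpha] is [Z_{,alpha'}] at [h] times [h_alpha], the bounds [c1], [c2] on [h_alpha] and
    on the growth of [|z_alpha|] combine to the ratio [c2 / c1]. *)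
Lemma invZaof_flow a t : 0 <= t <= T0 ->
  modulus (Zaof Psi (h a t) t)^-1 <= c2 / c1 * modulus (Zaof Psi a 0)^-1 /\
  modulus (Zaof Psi a 0)^-1 <= c2 / c1 * modulus (Zaof Psi (h a t) t)^-1.
Proof.
move=> tT.
have [za1 za2] := ab_za (AB tT) a; have [ha1 ha2] := ab_ha (AB tT) a.
rewrite da_zof0 da_zof// modulusM -/c1 -/c2 in za1 za2 ha1 ha2.
have z0 : 0 < modulus (Zaof Psi a 0) by rewrite modulus_gt0; exact: (sa_Za SA).
have zt : 0 < modulus (Zaof Psi (h a t) t) by rewrite modulus_gt0; exact: (sa_Za SA).
rewrite !modulusV; move: z0 zt za1 za2 ha1 ha2.
move: (modulus _) (modulus _) (modulus _) => eta B A A0 B0 za1 za2 ha1 ha2.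
have aux x y : 0 < x -> 0 < y -> c1 * x <= c2 * y -> y^-1 <= c2 / c1 * x^-1.
  move=> x0 y0 xy; rewrite -subr_ge0.
  have -> : c2 / c1 * x^-1 - y^-1 = (c2 * y - c1 * x) / (c1 * x * y).
    by field; rewrite !gt_eqF.
  by rewrite divr_ge0 ?subr_ge0// !mulr_ge0// ltW.
split; apply: aux => //.
  by apply: le_trans za1 _; rewrite mulrC ler_wpM2r// ltW.
by apply: le_trans za2; rewrite mulrC ler_wpM2l// ltW.
Qed.

(** The strain equals [z_{t alpha} / z_alpha], as [h_alpha] cancels. The numerator is at most
    [c2 |z_alpha(0)|] and the denominator at least [c1 |z_alpha(0)|]. *)
Lemma strain_le a t : 0 <= t <= T0 ->
  modulus (Ztaof F (h a t) t * (Zaof Psi (h a t) t)^-1) <= c2 / c1.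
Proof.
move=> tT.
have [za1 za2] := ab_za (AB tT) a; have [ha1 ha2] := ab_ha (AB tT) a.
have := ab_zta_pt (AB tT) a.
have -> : da (dt T0 (zof Psi h)) a t = Ztaof F (h a t) t * da (cplx h) a t.
  rewrite -(deriv_setT (has_deriv_Ztof_comp tT)) /da; congr Defs.deriv.
  by apply/funext => b; rewrite (sa_zt SA).
rewrite da_zof0 da_zof// !modulusM -/c1 -/c2 in za1 za2 ha1 ha2 *.
rewrite modulusV => H.
have z0 : 0 < modulus (Zaof Psi a 0) by rewrite modulus_gt0; exact: (sa_Za SA).
have zt : 0 < modulus (Zaof Psi (h a t) t) by rewrite modulus_gt0; exact: (sa_Za SA).
have ha0 : 0 < modulus (da (cplx h) a t) by exact: lt_le_trans ha1.
move: z0 zt ha0 za1 H.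
move: (modulus _) (modulus _) (modulus _) (modulus _) => f eta B A A0 B0 eta0 za1 H.
rewrite ler_pdivrMr// mulrAC ler_pdivlMr// -(ler_pM2r eta0).
apply: (@le_trans _ _ (c2 * A * c1)); first by rewrite mulrAC ler_wpM2r// ltW.
by rewrite -!mulrA ler_wpM2l ?(ltW c20)// mulrC.
Qed.

(** The hypotheses concern labels at time 0 only; the bi-Lipschitz flow and [invZaof_flow] turn them
    into those of [sum_strain_le] at every time. As [1 / Z_{,alpha'}] never vanishes for an
    approximation, it is instead required to be small at [a0] compared with the distances of the
    [a i]. *)
Lemma approx_sum_direction (m : nat) (a : 'I_m -> R) (a0 del : R) :
  0 < del ->
  (forall i j : 'I_m, (i < j)%N -> c2 * `|a j - a0| <= c1 * `|a i - a0| / 2) ->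
  (forall i, a i != a0) ->
  (forall i, c2 / c1 * modulus (Zaof Psi a0 0)^-1 <= C0 * Num.sqrt (c1 * `|a i - a0|)) ->
  forall t, 0 <= t <= T0 ->
  \sum_i modulus (direction (Zaof Psi (h (a i) t) t) - direction (Zaof Psi (a i) 0)) <=
    T0 * (C0 ^+ 2 * (81 * (4 * C0 + 2 * C0 / del) ^+ 2 / (8 * del ^+ 2)) * (c2 / c1)
          + m%:R * del).
Proof.
move=> del0 adec aa0 w0 t tT; set B := _ + _.
have C00 : 0 < C0 := CE1_gt0.
have B0 : 0 <= B.
  apply: addr_ge0; last by rewrite mulr_ge0// ltW.
  apply: mulr_ge0; last by rewrite divr_ge0// ltW.
  by apply: mulr_ge0; [exact: sqr_ge0|apply: divr_ge0; rewrite mulr_ge0 ?sqr_ge0].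
have [rho Hrho] := has_deriv_Zaof_flow.
have main := @sum_direction_le R m (fun i s => Zaof Psi (h (a i) s) s)
  (fun i s => Ztaof F (h (a i) s) s * (Zaof Psi (h (a i) s) s)^-1)
  (fun i s => rho (a i) s) T0 B.
apply: (@le_trans _ _ (t * B)); last by rewrite ler_wpM2r//; case/andP: tT.
under eq_bigr => i _ do rewrite -{2}[a i](sa_flow0 SA).
apply: main => // [i s sT|i s sT|s sT]; [exact: (sa_Za SA)|exact: Hrho|].
have CEC : ((CE K e)%:E <= C0%:E)%E by rewrite lee_fin lerDl.
have C1Z : C1 (Zaof Psi ^~ s) by exact: (smooth_line_C1 Zsmooth sT).
have C1Zt : C1 (Ztaof F ^~ s) by exact: (smooth_line_C1 Ztsmooth sT).
have Za0 x : Zaof Psi x s != 0 by exact: (sa_Za SA).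
have C1w := C1V Za0 C1Z.
have C1q : C1 (fun x => (Zaof Psi x s ^+ 2)^-1 * Ztaof F x s).
  have Z20 x : Zaof Psi x s ^+ 2 != 0 by rewrite expf_neq0.
  exact: (C1M (C1V Z20 (C1M C1Z C1Z)) C1Zt).
have hw := C1_holder C1w C00 (le_trans (ab_invZa (AB sT)) CEC).
have hq := C1_holder C1q C00 (le_trans (ab_ZZta (AB sT)) CEC).
have lip i : c1 * `|a i - a0| <= `|h (a i) s - h a0 s| := (flow_biLipschitz _ _ sT).1.
apply: (@sum_strain_le R (fun x => (Zaof Psi x s)^-1) (Ztaof F ^~ s) C0 (c2 / c1) del
  m (fun i => h (a i) s) (h a0 s)) => //.
- by rewrite divr_ge0 ?ltW.
- exact: C1_continuous.
- exact: (le_trans (ab_Zta (AB sT)) CEC).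
- by move=> x; rewrite invr_eq0.
- by move=> x y; have := hq x y; rewrite !exprVn ![_^-1 * _]mulrC.
- move=> i j ij; have [_ H] := flow_biLipschitz (a j) a0 sT.
  by have := adec i j ij; have := lip i; lra.
- move=> i; rewrite -subr_eq0 -normr_gt0 (lt_le_trans _ (lip i))// mulr_gt0//.
  by rewrite normr_gt0 subr_eq0.
- move=> i; have [H _] := invZaof_flow a0 sT; apply: le_trans H _.
  apply: le_trans (w0 i) _; rewrite ler_wpM2l ?(ltW C00)// ler_wsqrtr//.
- by move=> i; exact: strain_le.
Qed.

(** Inside, holomorphy turns [dz Psi] into [dx Psi], which is continuous up to the boundary with the
    nonzero value [Zaof Psi a t]. *)
Lemma bext_invdz a t : 0 <= t <= T0 ->
  bext (invdz (Psi ^~ t)) a%:C = (Zaof Psi a t)^-1.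
Proof.
move=> tT; have [D [D0 HD]] := sa_Psi SA.
have bd : clhp (a%:C : C) by rewrite /clhp /=.
have E z : clhp z -> hline (Psi ^~ t) (complex.Im z) =
    hline (D 0%N 0%N 0%N ^~ t) (complex.Im z).
  by move=> zc; apply/funext => x; rewrite /hline D0.
have Dx z : clhp z -> dx (Psi ^~ t) z = D 1%N 0%N 0%N z t.
  move=> zc; have [_ /(_ z t zc tT)[H _ _]] := HD 0%N 0%N 0%N.
  by rewrite /dx E//; exact: deriv_setT H.
have Za : Zaof Psi a t = D 1%N 0%N 0%N a%:C t by rewrite -Dx.
have Za0 : D 1%N 0%N 0%N a%:C t != 0 by rewrite -Za; exact: (sa_Za SA).
rewrite Za; apply: bext_lim.
have H : D 1%N 0%N 0%N w t @[w --> within (@lhp R) (nbhs (a%:C : C))] -->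
    D 1%N 0%N 0%N a%:C t.
  apply/cvgC_modulus => d d0.
  have [cD _] := HD 1%N 0%N 0%N.
  have [r r0 Hr] := cont_on_clhpP cD bd tT d0.
  apply/nbhs_ballP; exists r%:C => /=; first by rewrite ltcR.
  move=> z; rewrite /ball /= normCE ltcR modulusBC => zr zl.
  by rewrite modulusBC; apply: Hr => //; [exact: ltW|rewrite modulusBC|rewrite subrr normr0].
apply: cvg_trans (cvgVC Za0 H); apply: near_eq_cvg.
apply/nbhs_ballP; exists 1 => //= z _ zl; rewrite /invdz.
have [holo _] := ww_conformal (sa_system SA) tT.
have zc : clhp z by exact: ltW.
by have -> : dz (Psi ^~ t) z = D 1%N 0%N 0%N z t
  by rewrite (dz_holomorphic (holo z zl)) (Dx z zc).
Qed.

End Approximation.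

(** * Passage to the limit *)

Section CompactConvergence.
Variable R : realType.
Local Notation C := R[i].

Lemma cvg_cpt_near (X : topologicalType) (D : set X) (T0 : R) (V : pseudoMetricType R)
    (Gn : nat -> X -> R -> V) G (A : set (X * R)) (d : R) :
  cvg_cpt D T0 Gn G -> compact A -> A `<=` D `*` `[0, T0] -> 0 < d ->
  \forall n \near \oo, forall p, A p -> ball (G p.1 p.2) d (Gn n p.1 p.2).
Proof.
move=> H cA AD d0; have {}H := H A cA AD.
apply: (H [set f | forall p, A p -> ball (G p.1 p.2) d (f p)]).
apply/uniform_nbhs; exists [set vw | ball vw.1 d vw.2]; split => //.
by rewrite -entourage_from_ballE; exists d.
Qed.

Lemma cvg_cptC_near (X : topologicalType) (D : set X) (T0 : R)
    (Gn : nat -> X -> R -> C) G (A : set (X * R)) (d : R) :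
  cvg_cpt D T0 Gn G -> compact A -> A `<=` D `*` `[0, T0] -> 0 < d ->
  \forall n \near \oo, forall p, A p -> modulus (Gn n p.1 p.2 - G p.1 p.2) < d.
Proof.
move=> H cA AD d0; have {}H := H A cA AD.
apply: (H [set f | forall p, A p -> modulus (f p - G p.1 p.2) < d]).
apply/uniform_nbhs; exists [set vw : C * C | ball vw.1 d%:C vw.2]; split.
  by rewrite -entourage_from_ballE; exists d%:C => //=; rewrite ltcR.
by move=> f H' p /H'; rewrite /ball /= normCE ltcR modulusBC.
Qed.

End CompactConvergence.

(** * Limits of boundary traces, tangents and rotations *)

Section Limit.
Variables (R : realType) (K : wu_constants R) (e c T0 : R).
Local Notation C := R[i].
Variables (F0 Psi0 : C -> C) (eps_ : nat -> R) (Fn Psin : nat -> C -> R -> C).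
Variables (Pn : nat -> C -> R -> R) (hn hinvn : nat -> R -> R -> R).
Variables (F Psi : C -> R -> C) (P : C -> R -> R) (h hinv : R -> R -> R).
Variable (z : R -> R -> C).
Hypothesis T00 : 0 < T0.
Hypothesis SA : forall n, smooth_approx T0 F0 Psi0 (eps_ n) (Fn n) (Psin n) (Pn n)
  (hn n) (hinvn n).
Hypothesis AB : forall n (t : R), 0 <= t <= T0 ->
  approx_bounds K e c T0 (Fn n) (Psin n) (hn n) t.
Hypothesis AL : approx_limit K e T0 Fn Psin Pn hn hinvn F Psi P h hinv z.
Hypothesis Wcont : cont_on (@clhp R) T0 (fun w t => bext (invdz (Psi ^~ t)) w).

Let c1 := cst1 K e.
Let c2 := cst2 K e.
Let c10 : 0 < c1. Proof. exact: cst1_gt0. Qed.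
Let c20 : 0 < c2. Proof. exact: cst2_gt0. Qed.

Let W (a t : R) : C := bext (invdz (Psi ^~ t)) a%:C.
Let Wn n (a t : R) : C := (Zaof (Psin n) a t)^-1.

Let real_clhp (a : R) : clhp (a%:C : C). Proof. by rewrite /clhp /=. Qed.

Lemma trace_invdz_continuous a t (d : R) : 0 <= t <= T0 -> 0 < d ->
  exists2 r, 0 < r & forall b, `|b - a| < r -> modulus (W b t - W a t) < d.
Proof.
move=> tT d0; have [r r0 H] := cont_on_clhpP Wcont (real_clhp a) tT d0.
exists r => // b ba; apply: H => //; first by rewrite -rmorphB modulusR.
by rewrite subrr normr0.
Qed.

(** The traces converge uniformly on the compact segment of radius 1 about [a], at the fixed time
    [t]. *)
Lemma trace_invdz_near a t (d : R) : 0 <= t <= T0 -> 0 < d ->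
  \forall n \near \oo, forall b, `|b - a| <= 1 -> modulus (Wn n b t - W b t) < d.
Proof.
move=> tT d0.
pose A := [set ((b%:C : C), t) | b in `[a - 1, a + 1]%classic].
have cA : compact A.
  apply: continuous_compact; last exact: segment_compact.
  apply: continuous_subspaceT => b.
  have cb : (b'%:C : C) @[b' --> b] --> (b%:C : C).
    apply/cvgC_modulus => r r0; apply/nbhs_ballP; exists r => // b'.
    by rewrite /ball /= distrC subrr expr0n addr0 sqrtr_sqr.
  have ct : t @[b' --> b] --> t by exact: cvg_cst.
  exact: (cvg_pair cb ct).
have AD : A `<=` @clhp R `*` `[0, T0].
  by move=> _ [b _ <-]; split => /=; [exact: real_clhp|rewrite in_itv].
have := cvg_cptC_near (al_invdz AL) cA AD d0.
apply: filterS => n H b ba; have := H (b%:C, t).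
rewrite /= (bext_invdz (SA n) b tT); apply; exists b => //=; rewrite in_itv /=.
by move: ba; rewrite ler_norml => /andP[? ?]; apply/andP; split; lra.
Qed.

Lemma flow_cvg a t : 0 <= t <= T0 -> hn n a t @[n --> \oo] --> h a t.
Proof.
move=> tT; apply/cvgrPdist_lt => d d0.
have AD : [set (a, t)] `<=` [set: R] `*` `[0, T0] by move=> _ ->; split; rewrite /= ?in_itv.
have cA : compact [set (a, t)] by exact: compact_set1.
have := cvg_cpt_near (al_h AL) cA AD d0.
by apply: filterS => n /(_ (a, t) erefl).
Qed.

(** The evaluation points move with [n]: local uniform convergence combines with continuity of the
    limit trace. *)
Lemma trace_invdz_flow_cvg a t : 0 <= t <= T0 -> Wn n (hn n a t) t @[n --> \oo] --> W (h a t) t.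
Proof.
move=> tT; apply/cvgC_modulus => d d0; have d20 : 0 < d / 2 by rewrite divr_gt0.
have [r r0 Hr] := trace_invdz_continuous (h a t) tT d20.
have U := trace_invdz_near (h a t) tT d20.
have r10 : 0 < Num.min 1 r by rewrite lt_min ltr01.
have /cvgrPdist_lt/(_ _ r10) H := @flow_cvg a t tT.
near=> n.
have : `|h a t - hn n a t| < Num.min 1 r by near: n; exact: H.
rewrite lt_min distrC => /andP[n1 nr].
have H1 : modulus (Wn n (hn n a t) t - W (hn n a t) t) < d / 2.
  by move: (ltW n1); move: (hn n a t); near: n; exact: U.
apply: le_lt_trans (ler_modulus_dist (W (hn n a t) t) _ _) _.
by rewrite (splitr d); apply: ltrD H1 (Hr _ nr).
Unshelve. all: by end_near. Qed.

Let T0I : 0 <= (0 : R) <= T0. Proof. by rewrite lexx ltW. Qed.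

Lemma trace_invdz_cvg a : Wn n a 0 @[n --> \oo] --> W a 0.
Proof.
have := @trace_invdz_flow_cvg a 0 T0I; rewrite (al_h0 AL); apply: cvg_trans; apply: near_eq_cvg.
by apply: nearW => n; rewrite (sa_flow0 (SA n)).
Qed.

(** The comparison passes to the limit for [1 / Z_{,alpha'}], which stays finite at singular points;
    there it transports zeros in both directions. *)
Lemma trace_invdz_flow a t : 0 <= t <= T0 ->
  modulus (W (h a t) t) <= c2 / c1 * modulus (W a 0) /\
  modulus (W a 0) <= c2 / c1 * modulus (W (h a t) t).
Proof.
move=> tT.
have H1 : modulus (Wn n (hn n a t) t) @[n --> \oo] --> modulus (W (h a t) t).
  exact: cvg_modulus (@trace_invdz_flow_cvg a t tT).
have H2 : modulus (Wn n a 0) @[n --> \oo] --> modulus (W a 0).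
  exact: cvg_modulus (@trace_invdz_cvg a).
have H n := invZaof_flow T00 (SA n) (AB n) a tT.
split; [apply: (ler_cvg_to H1 (cvgM (cvg_cst (c2 / c1)) H2))|
        apply: (ler_cvg_to H2 (cvgM (cvg_cst (c2 / c1)) H1))];
  by apply: nearW => n; have [] := H n.
Qed.

Lemma trace_invdz_flow_eq0 a t : 0 <= t <= T0 -> W (h a t) t = 0 <-> W a 0 = 0.
Proof.
move=> tT; have [H1 H2] := trace_invdz_flow a tT.
split=> E; apply: Normc.eq0_normc; apply/le_anti; rewrite modulus_ge0 andbT.
  by apply: le_trans H2 _; rewrite E modulus0 mulr0.
by apply: le_trans H1 _; rewrite E modulus0 mulr0.
Qed.

(** Near a nonsingular point the derivatives of the approximations are close to [1 / W], uniformly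
    for large [n]. The mean value inequality gives a first-order expansion on a neighbourhood
    independent of [n], which survives the limit. *)
Lemma Zaof_trace_invdz a t : 0 <= t <= T0 -> W a t != 0 -> Zaof Psi a t = (W a t)^-1.
Proof.
move=> tT w0; apply: deriv_setT; apply/has_derivP => d d0.
have m0 : 0 < modulus (W a t) by rewrite modulus_gt0.
(* The threshold of [modulus_inv_dist]: one half is spent on the approximation, one half on the
   continuity of [W]. *)
pose eta := Num.min (modulus (W a t) / 2) (d * modulus (W a t) ^+ 2 / 2).
have eta0 : 0 < eta by rewrite lt_min !divr_gt0// mulr_gt0// exprn_gt0.
have eta20 : 0 < eta / 2 by rewrite divr_gt0.
have [r r0 Hr] := trace_invdz_continuous a tT eta20.
have U := trace_invdz_near a tT eta20.
exists (Num.min 1 r) => [|b _]; first by rewrite lt_min ltr01.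
rewrite lt_min => /andP[b1 br].
have pt x : Zof (Psin n) x t @[n --> \oo] --> Zof Psi x t.
  apply/cvgC_modulus => d' d'0.
  have AD : [set ((x%:C : C), t)] `<=` @clhp R `*` `[0, T0].
    by move=> _ ->; split => /=; [exact: real_clhp|rewrite in_itv].
  have cA : compact [set ((x%:C : C), t)] by exact: compact_set1.
  have := cvg_cptC_near (al_Psi AL) cA AD d'0.
  by apply: filterS => n /(_ (x%:C, t) erefl).
have L : modulus (Zof (Psin n) b t - Zof (Psin n) a t - (W a t)^-1 * (b - a)%:C)
    @[n --> \oo] --> modulus (Zof Psi b t - Zof Psi a t - (W a t)^-1 * (b - a)%:C).
  apply: cvg_modulus.
  have cN (f : nat -> C) (l : C) : f @ \oo --> l -> (fun n => - f n) @ \oo --> - l.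
    by move=> fl; exact: (cvgN fl).
  have cc : (W a t)^-1 * (b - a)%:C @[n --> \oo] --> (W a t)^-1 * (b - a)%:C.
    exact: cvg_cst.
  exact: (cvgDC (cvgDC (pt b) (cN _ _ (pt a))) (cN _ _ cc)).
apply: (cvgr_to_le L); apply: filterS U => n Un.
have [_ [_ DZ _ _ _]] := smooth_line_da (smooth_clhp_line (sa_Psi (SA n))).
apply: (@mean_value_le R (Zof (Psin n) ^~ t) (Zaof (Psin n) ^~ t)) => x xab.
  exact: DZ.
have xb : `|x - a| <= `|b - a|.
  exact: ler_norm_between.
have {}Un := Un x (le_trans xb (ltW b1)); have {}Hr := Hr x (le_lt_trans xb br).
have Wx : modulus (Wn n x t - W a t) < eta.
  apply: le_lt_trans (ler_modulus_dist (W x t) _ _) _.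
  by have := ltrD Un Hr; rewrite -splitr.
have -> : Zaof (Psin n) x t = (Wn n x t)^-1 by rewrite /Wn invrK.
exact: modulus_inv_dist.
Qed.

Lemma direction_flow_cvg a t : 0 <= t <= T0 -> W (h a t) t != 0 ->
  direction (Zaof (Psin n) (hn n a t) t) @[n --> \oo] --> direction (Zaof Psi (h a t) t).
Proof.
move=> tT w0; rewrite Zaof_trace_invdz//.
have w1 : (W (h a t) t)^-1 != 0 by rewrite invr_eq0.
have H := cvg_direction w1 (cvgVC w0 (@trace_invdz_flow_cvg a t tT)).
have -> : (fun n => direction (Zaof (Psin n) (hn n a t) t)) =
    (fun n => direction (Wn n (hn n a t) t)^-1) by apply/funext => n; rewrite invrK.
exact: H.
Qed.

Let turn (a t : R) : R :=
  modulus (direction (Zaof Psi (h a t) t) - direction (Zaof Psi a 0)).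
Let turnn n (a t : R) : R :=
  modulus (direction (Zaof (Psin n) (hn n a t) t) - direction (Zaof (Psin n) a 0)).

Lemma turn_cvg a t : 0 <= t <= T0 -> W a 0 != 0 ->
  turnn n a t @[n --> \oo] --> turn a t.
Proof.
move=> tT w0; apply: cvg_modulus.
have wt : W (h a t) t != 0.
  by apply/eqP => /(trace_invdz_flow_eq0 a tT).1; apply/eqP.
have w00 : W (h a 0) 0 != 0 by rewrite (al_h0 AL).
have H0 : direction (Zaof (Psin n) a 0) @[n --> \oo] --> direction (Zaof Psi a 0).
  have := direction_flow_cvg T0I w00; rewrite (al_h0 AL).
  have -> // : (fun n => direction (Zaof (Psin n) (hn n a 0) 0)) =
    (fun n => direction (Zaof (Psin n) a 0)).
  by apply/funext => n; rewrite (sa_flow0 (SA n)).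
have HN : - direction (Zaof (Psin n) a 0) @[n --> \oo] --> - direction (Zaof Psi a 0).
  exact: (cvgN H0).
exact: (cvgDC (direction_flow_cvg tT wt) HN).
Qed.

(** For finitely many particles, a single large [n] satisfies all the strict inequalities at once,
    and the estimate for that approximation applies. *)
Lemma sum_turn_le (m : nat) (a : 'I_m -> R) (a0 del d t : R) :
  0 <= t <= T0 -> 0 < del -> W a0 0 = 0 ->
  (forall i j : 'I_m, (i < j)%N -> c2 * `|a j - a0| <= c1 * `|a i - a0| / 2) ->
  (forall i, a i != a0) -> (forall i, W (a i) 0 != 0) ->
  (forall i, d < turn (a i) t) ->
  m%:R * d <= T0 * ((CE K e + 1) ^+ 2 *
     (81 * (4 * (CE K e + 1) + 2 * (CE K e + 1) / del) ^+ 2 / (8 * del ^+ 2)) * (c2 / c1)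
          + m%:R * del).
Proof.
move=> tT del0 w0 adec aa0 wa da.
have C00 : 0 < CE K e + 1 := CE1_gt0 T00 (AB 0).
(* The size allowed to [1 / Z_{,alpha'}] at [a0]; it is positive, hence eventually respected because
   the limit [W a0 0] vanishes. *)
pose s i := (CE K e + 1) * Num.sqrt (c1 * `|a i - a0|) / (c2 / c1).
have s0 i : 0 < s i.
  rewrite !divr_gt0// mulr_gt0// sqrtr_gt0 mulr_gt0//.
  by rewrite normr_gt0 subr_eq0.
have near1 : \forall n \near \oo, forall i, d < turnn n (a i) t.
  apply: filter_forall => i.
  exact: (cvgr_gt (turn (a i) t) (turn_cvg tT (wa i)) _ (da i)).
have near2 : \forall n \near \oo, forall i, modulus (Zaof (Psin n) a0 0)^-1 < s i.
  apply: filter_forall => i.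
  have L : modulus (Zaof (Psin n) a0 0)^-1 @[n --> \oo] --> (0 : R).
    have H : modulus (Wn n a0 0) @[n --> \oo] --> modulus (W a0 0).
      exact: cvg_modulus (@trace_invdz_cvg a0).
    by rewrite w0 modulus0 in H.
  exact: (cvgr_lt 0 L _ (s0 i)).
have [n [n1 n2]] := filter_ex (filterI near1 near2).
apply: le_trans (approx_sum_direction T00 (SA n) (AB n) del0 adec aa0 _ tT); last first.
  by move=> i; rewrite mulrC -ler_pdivlMr ?divr_gt0//; exact: ltW (n2 i).
have -> : m%:R * d = \sum_(i < m) d by rewrite sumr_const card_ord mulr_natl.
by apply: ler_sum => i _; exact: ltW (n1 i).
Qed.

(** Otherwise particles turning by at least [d] exist arbitrarily close to [a0]. Choosing [m] of
    them at geometrically decreasing distances makes the left side of [sum_turn_le] outgrow the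
    right. *)
Lemma turn_small a0 t d : 0 <= t <= T0 -> 0 < d -> W a0 0 = 0 ->
  (exists2 r, 0 < r & forall a, a != a0 -> `|a - a0| < r -> W a 0 != 0) ->
  exists2 r, 0 < r & forall a, a != a0 -> `|a - a0| < r -> turn a t < d.
Proof.
move=> tT d0 w0 [r0 r00 Wr]; apply: contrapT => nH.
have c12 : c1 <= c2.
  by have [H1 H2] := ab_ha (AB 0 T0I) 0; exact: le_trans H1 H2.
have bad r : exists a, 0 < r ->
    [/\ a != a0, `|a - a0| < r, W a 0 != 0 & d <= turn a t].
  have [r1|] := boolP (0 < r); last by exists 0.
  apply: contrapT => H; apply: nH; exists (Num.min r r0); first by rewrite lt_min r1 r00.
  move=> a aa0; rewrite lt_min => /andP[ar ar0]; rewrite ltNge; apply/negP => da.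
  by apply: H; exists a => _; split=> //; exact: Wr.
pose f r := projT1 (cid (bad r)).
have fP r : 0 < r -> [/\ f r != a0, `|f r - a0| < r, W (f r) 0 != 0 & d <= turn (f r) t].
  exact: (projT2 (cid (bad r))).
(* This radius ensures [c2 |next x - a0| <= c1 |x - a0| / 2], the decay required of the labels. *)
pose next x := f (c1 * `|x - a0| / (2 * c2)).
pose a_ k := iter k next (f 1).
have rad x : x != a0 -> 0 < c1 * `|x - a0| / (2 * c2).
  by move=> xa0; rewrite divr_gt0 ?mulr_gt0// normr_gt0 subr_eq0.
have aP k : [/\ a_ k != a0, W (a_ k) 0 != 0 & d <= turn (a_ k) t].
  elim: k => [|k [aa0 _ _]]; first by have [] := fP 1 ltr01.
  by have [] := fP _ (rad _ aa0).
have dec k : c2 * `|a_ k.+1 - a0| <= c1 * `|a_ k - a0| / 2.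
  have [aa0 _ _] := aP k; have [_ H _ _] := fP _ (rad _ aa0).
  rewrite mulrC -ler_pdivlMr//; apply: le_trans (ltW H) _.
  by rewrite invfM !mulrA.
have mono k : `|a_ k.+1 - a0| <= `|a_ k - a0|.
  rewrite -(ler_pM2l c20); apply: le_trans (dec k) _.
  have := ler_wpM2r (normr_ge0 (a_ k - a0)) c12.
  have := mulr_ge0 (ltW c20) (normr_ge0 (a_ k - a0)).
  by move: (c1 * _) (c2 * _) => u v; lra.
have adec i j : (i < j)%N -> c2 * `|a_ j - a0| <= c1 * `|a_ i - a0| / 2.
  move=> ij; apply: le_trans (dec i); rewrite ler_wpM2l ?(ltW c20)//.
  elim: j ij => // j IH; rewrite ltnS leq_eqVlt => /orP[/eqP ->//|/IH H].
  exact: le_trans (mono j) H.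
(* The term [T0 * m * del] becomes [m * d / 4]. *)
pose del := d / (4 * T0).
have del0 : 0 < del by rewrite divr_gt0// mulr_gt0.
pose X := (CE K e + 1) ^+ 2 *
     (81 * (4 * (CE K e + 1) + 2 * (CE K e + 1) / del) ^+ 2 / (8 * del ^+ 2)) * (c2 / c1).
have X0 : 0 <= X.
  apply: mulr_ge0; last exact: (divr_ge0 (ltW c20) (ltW c10)).
  by apply: mulr_ge0; [exact: sqr_ge0|apply: divr_ge0; rewrite mulr_ge0 ?sqr_ge0].
(* The turn is only known to be at least [d], and a strict bound is required, hence [3 / 4 * d]. *)
have main m : m%:R * (3 / 4 * d) <= T0 * (X + m%:R * del).
  apply: (@sum_turn_le m (fun i => a_ i) a0 del (3 / 4 * d) t tT del0 w0)
    => // [i j ij|i|i|i].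
  - exact: adec.
  - by have [] := aP i.
  - by have [] := aP i.
  - by have [_ _] := aP i; apply: lt_le_trans; lra.
have Y0 : 0 <= 2 * T0 * X / d.
  apply: divr_ge0 (ltW d0); apply: mulr_ge0 X0.
  by apply: mulr_ge0 => //; exact: ltW.
(* The estimate gives [m * d / 2 <= T0 * X], which fails once [m] exceeds [2 * T0 * X / d]. *)
have := archi_boundP Y0; set m := Num.bound _; rewrite ltr_pdivrMr// => mY.
have := main m; rewrite mulrDr.
have -> : T0 * (m%:R * del) = m%:R * d / 4 by rewrite /del; field; rewrite gt_eqF.
move: mY; move: (m%:R) (X) => M Y; lra.
Qed.

End Limit.

(** * Transport of isolated singularities and of their one-sided tangents *)

Lemma isolatedP (R : realType) (S : set R) (x : R) : isolated S x <->
  S x /\ exists2 r, 0 < r & forall y, y != x -> `|y - x| < r -> ~ S y.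
Proof.
split=> [[/set_mem Sx [V /nbhs_ballP[r /= r0 rV] VS]]|[Sx [r r0 H]]].
  split=> //; exists r => // y yx yr Sy.
  have : [set x] y by rewrite -VS; split=> //; apply: rV; rewrite /ball /= distrC.
  by move=> /= yx'; rewrite yx' eqxx in yx.
split; first exact: mem_set.
exists (ball x r); first exact: nbhsx_ballx.
apply/seteqP; split=> [y [yr Sy]|_ ->]; last by split=> //; exact: ballxx.
by apply/eqP; apply: contrapT => /negP yx; apply: (H y yx) Sy; rewrite distrC.
Qed.

Theorem corollary3p3 (R : realType) (K : wu_constants R) (T0 : R)
    (F Psi : R[i] -> R -> R[i]) (P : R[i] -> R -> R) (h : R -> R -> R)
    (N : nat) (alpha : 'I_N -> R) (beta gamma : 'I_N -> R[i]) :
  0 < T0 ->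
  wu_solution K T0 F Psi P h ->
  (1 <= N)%N ->
  injective alpha ->
  (forall n, isolated (singular_set Psi 0) (alpha n)) ->
  (forall n, `|beta n| = 1 /\ `|gamma n| = 1) ->
  (forall n, tangent Psi a 0 @[a --> (alpha n)^'-] --> beta n /\
             tangent Psi a 0 @[a --> (alpha n)^'+] --> gamma n) ->
  forall t : R, 0 <= t <= T0 ->
    injective (fun n => h (alpha n) t) /\
    forall n,
      [/\ isolated (singular_set Psi t) (h (alpha n) t),
          tangent Psi (h a t) t @[a --> (alpha n)^'-] --> beta n &
          tangent Psi (h a t) t @[a --> (alpha n)^'+] --> gamma n].
Proof.
move=> T00 WS _ ainj iso _ lim t tT.
have [Fe [Psie [Pe [he [hinve [SA AB [eps_ [hinv [z [eps1 _ AL]]]]]]]]]] := ws_approx WS.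
set e := fine (energy1 _ _) in AL AB; set c := fine (c0 _ _) in AB.
have SAn n := SA _ (eps1 n).
have ABn n (s : R) (sT : 0 <= s <= T0) := AB _ s (eps1 n) sT.
have c10 := cst1_gt0 K e.
have flow0 a : singular_set Psi t (h a t) <-> singular_set Psi 0 a.
  exact: (trace_invdz_flow_eq0 T00 SAn ABn AL (ws_invdz_cont WS) a tT).
have hinj a b : h a t = h b t -> a = b.
  by move=> E; rewrite -[a]((al_hinv AL tT).1) -[b]((al_hinv AL tT).1) /= E.
split=> [n m /= /hinj/ainj //|n].
have /isolatedP[Sn [r r0 Hr]] := iso n.
have lip x y : cst1 K e * `|x - y| <= `|h x t - h y t|.
  have [->|xy] := eqVneq x y; first by rewrite !subrr normr0 mulr0.
  have [H _] := al_h_lip AL tT xy.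
  have xy0 : 0 < `|x - y| by rewrite normr_gt0 subr_eq0.
  rewrite -ler_pdivlMr// -normf_div; exact: le_trans H (ler_norm _).
have small d : 0 < d -> exists2 r', 0 < r' & forall a, a != alpha n -> `|a - alpha n| < r' ->
    modulus (tangent Psi (h a t) t - tangent Psi a 0) < d.
  move=> d0.
  apply: (turn_small T00 SAn ABn AL (ws_invdz_cont WS) tT d0 Sn).
  by exists r => // a an ar; apply/eqP; exact: Hr.
(* One argument serves both one-sided limits: it uses only that the filter concentrates on punctured
   neighbourhoods of [alpha n]. *)
have tan_lim (FF : set_system R) (b : R[i]) : Filter FF ->
    (forall d, 0 < d -> FF [set a | a != alpha n /\ `|a - alpha n| < d]) ->
    tangent Psi a 0 @[a --> FF] --> b -> tangent Psi (h a t) t @[a --> FF] --> b.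
  move=> FFF FFn /cvgC_modulus H; apply/cvgC_modulus => d d0.
  have d20 : 0 < d / 2 by rewrite divr_gt0.
  have [r' r'0 Hr'] := small _ d20.
  apply: filterS (filterI (FFn _ r'0) (H _ d20)) => a [[an ar] Ha].
  apply: le_lt_trans (ler_modulus_dist (tangent Psi a 0) _ _) _.
  by have := ltrD (Hr' a an ar) Ha; rewrite -splitr.
have [lim1 lim2] := lim n.
split.
- apply/isolatedP; split; first exact/flow0.
  (* By the lower Lipschitz bound, a point within this distance of [h (alpha n) t] has its label
     within [r] of [alpha n]. *)
  exists (cst1 K e * r) => [|y yn yr]; first by rewrite mulr_gt0.
  rewrite -[y]((al_hinv AL tT).2) /= in yn yr *; move: (hinv y t) yn yr => a an ar.
  move=> /flow0; apply: Hr.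
    by apply: contra_neq an => ->.
  by rewrite -(ltr_pM2l c10); exact: le_lt_trans (lip _ _) ar.
- apply: tan_lim lim1 => d d0; apply/nbhs_ballP; exists d => //= a.
  by rewrite /ball /= distrC => ad an; rewrite lt_eqF.
- apply: tan_lim lim2 => d d0; apply/nbhs_ballP; exists d => //= a.
  by rewrite /ball /= distrC => ad an; rewrite gt_eqF.
Qed.
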